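(* Let $C$ be a non-empty, compact and convex subset of $\mathbb{R}^n$, let $K:C\rightrightarrows\mathbb{R}^n$ be a set-valued map and let $f:\mathbb{R}^n\times\mathbb{R}^n\to\mathbb{R}$ be a bifunction. Let $P_C$ be the Euclidean projection onto $C$. Define $Q:C\times\mathbb{R}^n\rightrightarrows C\times\mathbb{R}^n$ by $Q(x,z)=P_C(z)\times K(x)$, and $R:C\times\mathbb{R}^n\rightrightarrows\mathbb{R}^n$ by $R(x,z)=\{y\in K(x): f(z,y)<0\}$. Assume that 1. $Q$ is lower semicontinuous with non-empty convex values; 2. $Q(C\times\mathbb{R}^n)$ is relatively compact; 3. $\mathrm{Fix}(Q)$ is closed; 4. $R$ is lower semicontinuous with convex values on $\mathrm{Fix}(Q)$; 5. $f(z,z)\ge 0$ for every $z\in M$, where $M=\{w\in K(C): \text{there exists } u\in C \text{ such that } (u,w)\in \mathrm{Fix}(Q)\}$. Then there exists a projected solution of the quasi-equilibrium problem associated to $f$ and $K$.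
   Context: $\|\cdot\|$ is the Euclidean norm and $P_C(z)=\{x\in C:\|z-x\|\le\|z-w\|\ \text{for all } w\in C\}$, viewed as a set-valued map. For a set-valued map $\Phi:X\rightrightarrows X$, $\mathrm{Fix}(\Phi)=\{x: x\in\Phi(x)\}$. The image of a set $A$ is $\Phi(A)=\bigcup_{a\in A}\Phi(a)$. Values of set-valued maps may be empty unless stated otherwise. A set-valued map $\Phi:X\rightrightarrows Y$ is lower semicontinuous if for any $x_0$, any net $(x_i)$ converging to $x_0$ and any $y_0\in \Phi(x_0)$, there exist a subnet $(x_{\varphi(j)})_{j\in J}$ and a net $(y_j)_{j\in J}$ converging to $y_0$ with $y_j\in\Phi(x_{\varphi(j)})$ for all $j$. For $D\subset\mathbb{R}^n$, $\mathrm{EP}(f,D)=\{x\in D: f(x,y)\ge 0\ \text{for all } y\in D\}$. A projected solution of the quasi-equilibrium problem associated to $f$ and $K:C\rightrightarrows\mathbb{R}^n$ is a point $x_0\in C$ for which there exists $z_0\in \mathrm{EP}(f,K(x_0))$ with $x_0\in P_C(z_0)$. *)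

(* Defs.v *)
From HB Require Import structures.
From mathcomp Require Import all_boot all_order all_algebra.
From mathcomp Require Import all_classical all_reals all_analysis.

Set Implicit Arguments.
Unset Strict Implicit.
Unset Printing Implicit Defensive.

Import Order.TTheory GRing.Theory Num.Theory.
Import numFieldNormedType.Exports.

Local Open Scope classical_set_scope.
Local Open Scope ring_scope.

(* A set-valued map X => Y is a function X -> set Y. When its domain is only a
   subset A of the ambient type, the values outside A are irrelevant, and every
   notion below takes A as an argument and looks only at points of A. *)

Record directedSet := DirectedSet {
  dcarrier :> Type ;
  dle : dcarrier -> dcarrier -> Prop ;
  dinhabited : inhabited dcarrier ;
  dle_refl : forall i, dle i i ;
  dle_trans : forall i j k, dle i j -> dle j k -> dle i k ;
  dle_directed : forall i j, exists k, dle i k /\ dle j k }.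

Definition tails (I : directedSet) : set_system I :=
  [set S | exists i0, forall i, dle i0 i -> S i].

Arguments tails : clear implicits.

Definition net_cvg (X : topologicalType) (I : directedSet) (x : I -> X)
    (x0 : X) : Prop :=
  x @ tails I --> x0.

(* x \o phi is then a subnet of x, for every net x indexed by I. *)
Definition subnet_map (I J : directedSet) (phi : J -> I) : Prop :=
  forall i0, exists j0, forall j, dle j0 j -> dle i0 (phi j).

(* Lower semicontinuity of the restriction of Phi to A, for the topology
   induced on A: a net of A converges in A to a point of A iff it does so in
   the ambient space. *)
Definition lower_semicontinuous_on (X Y : topologicalType) (A : set X)
    (Phi : X -> set Y) : Prop :=
  forall x0 : X, A x0 ->
  forall (I : directedSet) (x : I -> X),
    (forall i, A (x i)) -> net_cvg x x0 ->
  forall y0 : Y, Phi x0 y0 ->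
  exists (J : directedSet) (phi : J -> I) (y : J -> Y),
    [/\ subnet_map phi, net_cvg y y0 & forall j, Phi (x (phi j)) (y j)].

Definition Fix (X : Type) (A : set X) (Phi : X -> set X) : set X :=
  [set x | A x /\ Phi x x].

Definition image_sv (X Y : Type) (Phi : X -> set Y) (A : set X) : set Y :=
  \bigcup_(a in A) Phi a.

Definition relatively_compact (X : topologicalType) (A : set X) : Prop :=
  compact (closure A).

Section ProjectedSolutions.
Context {R : realType} {n : nat}.
Implicit Types (C D : set 'rV[R]_n) (K : 'rV[R]_n -> set 'rV[R]_n)
  (f : 'rV[R]_n -> 'rV[R]_n -> R).

(* The library norm on 'rV[R]_n is the maximum norm. It induces the same
   topology, but not the same projections. *)
Definition enorm (x : 'rV[R]_n) : R := Num.sqrt (\sum_(i < n) x 0 i ^+ 2).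

Definition proj C (z : 'rV[R]_n) : set 'rV[R]_n :=
  [set x | C x /\ forall w, C w -> enorm (z - x) <= enorm (z - w)].

Definition EP f D : set 'rV[R]_n :=
  [set x | D x /\ forall y, D y -> 0 <= f x y].

Definition projected_solution C K f (x0 : 'rV[R]_n) : Prop :=
  C x0 /\ exists z0, EP f (K x0) z0 /\ proj C z0 x0.

(* C x R^n, the domain of Qmap and Rmap. It is closed when C is, so that closed
   sets and closures in it are those of the ambient product. *)
Definition dom C : set ('rV[R]_n * 'rV[R]_n) := C `*` setT.

Definition Qmap C K (p : 'rV[R]_n * 'rV[R]_n) : set ('rV[R]_n * 'rV[R]_n) :=
  proj C p.2 `*` K p.1.

Definition Rmap K f (p : 'rV[R]_n * 'rV[R]_n) : set 'rV[R]_n :=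
  [set y | K p.1 y /\ f p.2 y < 0].

Definition Mset C K : set 'rV[R]_n :=
  [set w | image_sv K C w /\ exists u, C u /\ Fix (dom C) (Qmap C K) (u, w)].

End ProjectedSolutions.

(* Main.v *)
(* Since P_C is single valued, the fixed points of Q are the pairs (P_C z, z)
   with z in K (P_C z), so everything takes place in R^n: z |-> K (P_C z) is lower
   semicontinuous with non-empty convex values in a bounded set. If no projected
   solution existed, R would have non-empty values on the closed set Fix(Q), and
   replacing K (P_C z) by R (P_C z, z) there would again give a lower
   semicontinuous map with non-empty convex values. A fixed point of this map
   satisfies f z z < 0, a contradiction.

   The fixed point theorem for lower semicontinuous maps with non-empty convex,
   not necessarily closed, values in a bounded subset of R^n is proved following
   Michael: take countably many continuous selections of the closures of the
   values that are dense in the values at each point, and a fixed point of their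
   weighted sum. It lies in the value itself, because a non-closed convex set is
   still properly separated from any point outside it. Brouwer's theorem is
   obtained from Scarf's combinatorial lemma, and Schauder's from Brouwer's. *)

Require Import Defs.
From HB Require Import structures.
From mathcomp Require Import all_boot all_order all_algebra.
From mathcomp Require Import zify.

Set Implicit Arguments.
Unset Strict Implicit.
Unset Printing Implicit Defensive.

(** * Scarf's lemma *)

Section DominantSets.
Context {Z I : finType} (h : I -> Z -> nat).
Hypothesis h_inj : forall i, injective (h i).
Implicit Types (S T : {set Z}) (i : I) (z : Z).

(* No point exceeds the minimum of S in every one of the orders. *)
Definition dominant S :=
  [forall z, exists i, forall s in S, h i z <= h i s].

Lemma dominantP S :
  reflect (forall z, exists i, forall s, s \in S -> h i z <= h i s)
          (dominant S).
Proof.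
apply: (iffP forallP) => [dS z|dS z].
  have /existsP[i /forall_inP iS] := dS z; by exists i.
by have [i iS] := dS z; apply/existsP; exists i; apply/forall_inP.
Qed.

Lemma dominant_sub S T : T \subset S -> dominant S -> dominant T.
Proof.
move=> /subsetP TS /dominantP dS; apply/dominantP => z.
by have [i iS] := dS z; exists i => s /TS /iS.
Qed.

Lemma min_exists S : S != set0 ->
  exists m : I -> Z, forall i, m i \in S /\ forall s, s \in S -> h i (m i) <= h i s.
Proof.
move=> /set0Pn[z0 z0S]; exists (fun i => [arg min_(z < z0 in S) h i z]) => i.
by case: arg_minnP => // z zS zmin; split.
Qed.

(** When [m] gives the minima of a set, these points can be added without displacing any minimum
    except possibly the one for [a]. *)
Definition beyond (m : I -> Z) a :=
  [set z | [forall i, (i != a) ==> (h i (m i) < h i z)]].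

Lemma beyondP (m : I -> Z) a z :
  reflect (forall i, i != a -> h i (m i) < h i z) (z \in beyond m a).
Proof.
rewrite inE; apply: (iffP forallP) => [H i ia|H i]; first exact: (implyP (H i)).
by apply/implyP/H.
Qed.

Definition top a (M : {set Z}) := [set z in M | [forall w in M, h a w <= h a z]].

Lemma card_top a (M : {set Z}) : #|top a M| = (M != set0).
Proof.
have [->|/set0Pn[z0 z0M]] := eqVneq M set0.
  by apply: eq_card0 => z; rewrite !inE.
pose t := [arg max_(z > z0 in M) h a z].
have [tM tmax] : t \in M /\ forall w, w \in M -> h a w <= h a t.
  by rewrite /t; case: arg_maxnP => // t' ? H; split.
rewrite (_ : top a M = [set t]) ?cards1//; apply/setP => z; rewrite !inE.
apply/andP/eqP => [[zM /forall_inP zmax]|->].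
  by apply: (@h_inj a); apply/eqP; rewrite eqn_leq tmax// zmax.
by split=> //; apply/forall_inP.
Qed.

(* Adding v to T keeps T dominant only if v becomes the minimum for a or for b,
   the two orders that share their minimum on T. *)
Lemma dominant_extensions T (m : I -> Z) : T != set0 -> dominant T ->
  #|T|.+1 = #|I| ->
  (forall i, m i \in T /\ forall s, s \in T -> h i (m i) <= h i s) ->
  exists a b, [/\ a != b, m a = m b &
    #|[set v | (v \notin T) && dominant (v |: T)]| =
      (beyond m a != set0) + (beyond m b != set0)].
Proof.
move=> T0 dT cT mT.
have dTP := dominantP _ dT.
(* Dominance at a point of [T] itself makes it the minimum of [T] in some order. So [m] maps [I]
   onto [T], which is smaller by one, and two indices collide. *)
have m_surj t : t \in T -> exists i, m i = t.
  move=> tT; have [i it] := dTP t; exists i; apply: (@h_inj i); apply/eqP.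
  by rewrite eqn_leq (mT i).2// it// (mT i).1.
have mE : m @: I = T.
  apply/setP => t; apply/imsetP/idP => [[i _ ->]|/m_surj[i <-]]; last by exists i.
  by case: (mT i).
have /injectivePn[a [b ab mab]] : ~~ injectiveb m.
  apply/negP => /injectiveP mi; have := card_imset I mi.
  by rewrite mE => E; move: cT; rewrite -E => /eqP; rewrite eq_sym; lia.
have m_surj' c t : c = a \/ c = b -> t \in T -> exists2 i, i != c & m i = t.
  move=> cab /m_surj[i it]; have [ic|ic] := eqVneq i c; last by exists i.
  case: cab => cE; first by exists b; rewrite ?cE 1?eq_sym// -mab -cE -ic.
  by exists a; rewrite ?cE// mab -cE -ic.
exists a, b; split=> //.
rewrite -(card_top a) -(card_top b).
rewrite (_ : [set v | _] = top a (beyond m a) :|: top b (beyond m b)); last first.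
  have sym c d v : c = a /\ d = b \/ c = b /\ d = a ->
      v \in top c (beyond m c) -> v \notin T /\ dominant (v |: T).
    move=> cd; rewrite inE => /andP[/beyondP vM /forall_inP vmax].
    have vT : v \notin T.
      apply/negP => /(@m_surj' c) []; first by case: cd => -[-> _]; [left|right].
      by move=> i /vM + E; rewrite E ltnn.
    split=> //; apply/dominantP => z.
    (* A point beyond [m] for [c] is at most the maximal such point [v] in order [c]; any other is
       at most [m i] in some order [i] other than [c]. *)
    have [zM|] := boolP (z \in beyond m c).
      exists c => s /setU1P[->|sT]; first exact: vmax.
      have [i iz] := dTP z; have [<-|ic] := eqVneq i c; first exact: iz.
      by move/beyondP: zM => /(_ _ ic); rewrite ltnNge iz// (mT i).1.
    rewrite inE negb_forall => /existsP[i]; rewrite negb_imply -leqNgt => /andP[ic zi].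
    exists i => s /setU1P[->|sT]; first by apply: leq_trans zi (ltnW (vM _ ic)).
    by apply: leq_trans zi ((mT i).2 _ sT).
  apply/setP => v; rewrite !inE; apply/andP/orP; last first.
    by case=> H; [apply: (@sym a b)|apply: (@sym b a)]; rewrite ?inE//; auto.
  move=> [vT dv]; have dvP := dominantP _ dv.
  have vTT t : t \in T -> t != v by apply: contraTneq => ->.
  have [m' m'T] : exists m' : I -> Z, forall i, m' i \in v |: T /\
      forall s, s \in v |: T -> h i (m' i) <= h i s.
    by apply: min_exists; apply/set0Pn; exists v; rewrite setU11.
  have m'_surj t : t \in v |: T -> exists i, m' i = t.
    move=> tT; have [i it] := dvP t; exists i; apply: (@h_inj i); apply/eqP.
    by rewrite eqn_leq (m'T i).2// it// (m'T i).1.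
  have m'E : m' @: I = v |: T.
    apply/setP => t; apply/imsetP/idP => [[i _ ->]|/m'_surj[i <-]]; last by exists i.
    by case: (m'T i).
  (* [m'] maps [I] onto a set of the same size, so it is injective. It agrees with [m] wherever its
     value is not [v], so the collision of [a] and [b] makes [v] the minimum for one of them. *)
  have m'inj : injective m'.
    apply/injectiveP/negPn/negP => /negP m'i.
    have : #|m' @: I| == #|I| by rewrite m'E cardsU1 vT -cT.
    by move=> /imset_injP H; apply: m'i; apply/injectiveP => x y; apply: H.
  have m'm i : m' i != v -> m' i = m i.
    move=> ne; have [+ mini] := m'T i; rewrite !inE (negbTE ne)/= => iT.
    apply: (@h_inj i); apply/eqP; rewrite eqn_leq (mT i).2//.
    by rewrite mini// !inE (mT i).1 orbT.
  have key c : m' c = v -> v \in top c (beyond m c).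
    move=> cv; have bey i : i != c -> h i (m i) < h i v.
      move=> ic; have ne : m' i != v by rewrite -cv (inj_eq m'inj).
      rewrite ltn_neqAle -(m'm _ ne) (m'T i).2 ?setU11// andbT.
      by rewrite (inj_eq (@h_inj i)).
    rewrite inE; apply/andP; split; first exact/beyondP.
    apply/forall_inP => w /beyondP wM; have [i iw] := dvP w.
    have [<-|ic] := eqVneq i c; first by rewrite iw// setU11.
    by move: (wM _ ic); rewrite ltnNge iw// !inE (mT i).1 orbT.
  have [av|av] := eqVneq (m' a) v; first by left; have := key _ av; rewrite !inE.
  have [bv|bv] := eqVneq (m' b) v; first by right; have := key _ bv; rewrite !inE.
  by move: ab; rewrite -(inj_eq m'inj) (m'm _ av) (m'm _ bv) mab eqxx.
(* A point beyond [m] for both [a] and [b] would exceed every minimum, against the dominance of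
   [T]. *)
rewrite cardsU (_ : _ :&: _ = set0) ?cards0 ?subn0//.
apply/setP => v; rewrite !in_setI in_set0; apply/negP => /andP[].
rewrite inE => /andP[/beyondP va _]; rewrite inE => /andP[/beyondP vb _].
have [i iv] := dTP v; have := iv _ (mT i).1.
have [ia|ia] := eqVneq i a; last by rewrite leqNgt va.
by rewrite leqNgt vb// ia.
Qed.

End DominantSets.

(** * Coloured cells and parity *)

Section RainbowParity.
Context {Z I : finType} (c : Z -> I) (i0 : I).

(** Each door, a facet with exactly the colours other than [i0], is recorded by the vertex opposite
    to it. *)
Definition doors (S : {set Z}) := [set v in S | c @: (S :\ v) == ~: [set i0]].

(** A set with all colours has one door, opposite its vertex of colour [i0]. In any other set with a
    door [S :\ v], the colour of [v] recurs at exactly one other vertex [w], and the doors are those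
    opposite [v] and [w]. *)
Lemma odd_doors (S : {set Z}) : #|S| = #|I| ->
  odd #|doors S| = (c @: S == setT).
Proof.
move=> cS; have [full|nfull] := eqVneq (c @: S) setT.
  have cinj : {in S &, injective c}.
    by apply/imset_injP; rewrite full cardsT cS.
  have /imsetP[v vS iv] : i0 \in c @: S by rewrite full inE.
  rewrite (_ : doors S = [set v]) ?cards1//; apply/setP => u; rewrite !inE.
  apply/andP/eqP => [[uS /eqP E]|->].
    apply: (cinj) => //; rewrite -iv; apply/eqP; apply: contraT => ne.
    have : c u \in c @: (S :\ u) by rewrite E !inE.
    case/imsetP => w; rewrite !inE => /andP[wu wS] /cinj E'.
    by rewrite E' ?eqxx// in wu.
  split=> //; apply/eqP/setP => j; rewrite !inE; apply/imsetP/idP => [[w]|ji].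
    rewrite !inE => /andP[wv wS] ->; apply: contra wv => /eqP cw.
    by apply/eqP/cinj; rewrite // cw iv.
  have /imsetP[w wS jw] : j \in c @: S by rewrite full inE.
  exists w => //; rewrite !inE wS andbT; apply: contra ji => /eqP wv.
  by rewrite jw wv iv.
have [->|/set0Pn[v]] := eqVneq (doors S) set0; first by rewrite cards0.
rewrite inE => /andP[vS /eqP Ev].
have ncv : c v != i0.
  apply: contra nfull => /eqP cv; apply/eqP/setP => j; rewrite inE.
  have [->|ji] := eqVneq j i0; first by rewrite -cv imset_f.
  have : j \in c @: (S :\ v) by rewrite Ev !inE.
  by case/imsetP => w; rewrite !inE => /andP[_ wS] ->; rewrite imset_f.
have cinj : {in S :\ v &, injective c}.
  apply/imset_injP; rewrite Ev cardsCs setCK cards1 -cS (cardsD1 v S) vS.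
  by rewrite add1n subn1.
have /imsetP[w wSv cvw] : c v \in c @: (S :\ v) by rewrite Ev !inE.
have [wv wS] : w != v /\ w \in S by move: wSv; rewrite !inE => /andP.
rewrite (_ : doors S = [set v; w]) ?cards2 1?eq_sym ?wv//.
apply/setP => u; rewrite !inE; apply/andP/orP => [[uS /eqP Eu]|]; last first.
  case=> /eqP->; first by rewrite Ev.
  split=> //; rewrite -Ev; apply/eqP/setP => j.
  apply/imsetP/imsetP => -[t]; rewrite !inE => /andP[tne tS] ->.
    have [->|tv] := eqVneq t v; first by exists w.
    by exists t; rewrite // !inE tv.
  have [->|tw] := eqVneq t w; first by exists v; rewrite // !inE eq_sym wv.
  by exists t; rewrite // !inE tw.
have [->|uv] := eqVneq u v; [by left|right].
have : c u \in c @: (S :\ u).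
  by rewrite Eu -Ev; apply/imsetP; exists u; rewrite // !inE uv.
case/imsetP => t; rewrite !inE => /andP[tu tS] cut.
have [tv|tv] := eqVneq t v.
  by apply/eqP/cinj => //; [rewrite !inE uv|rewrite cut tv].
by case/eqP: tu; apply: (cinj) => //; rewrite !inE ?uv ?tv.
Qed.

(* Sperner's parity argument: double counting of the pairs (T, v |: T). *)
Lemma rainbow_cell (D : pred {set Z}) (T0 : {set Z}) :
  #|T0|.+1 = #|I| -> c @: T0 = ~: [set i0] ->
  (forall T : {set Z}, #|T|.+1 = #|I| -> c @: T = ~: [set i0] ->
     odd #|[set v | (v \notin T) && D (v |: T)]| = (T == T0)) ->
  exists S, [/\ D S, #|S| = #|I| & c @: S = setT].
Proof.
move=> cT0 eT0 oddT.
pose door (T : {set Z}) := (#|T|.+1 == #|I|) && (c @: T == ~: [set i0]).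
have doubleE : \sum_(T | door T) #|[set v | (v \notin T) && D (v |: T)]| =
    \sum_(S : {set Z} | D S && (#|S| == #|I|)) #|doors S|.
  under eq_bigr do rewrite -sum1_card big_mkcond/=.
  under [RHS]eq_bigr do rewrite -sum1_card big_mkcond/=.
  rewrite exchange_big/= [RHS]exchange_big/=; apply: eq_bigr => v _.
  rewrite -!big_mkcondr/=.
  rewrite (reindex_onto (fun S : {set Z} => S :\ v) (fun T => v |: T))/=; last first.
    move=> T /andP[_]; rewrite inE => /andP[vT _].
    by apply/setU1K.
  apply: eq_bigl => S; rewrite /door !inE eqxx/=.
  have [vS|vS] := boolP (v \in S); last first.
    rewrite (_ : v |: S :\ v == S = false) ?andbF//.
    by apply: contraNF vS => /eqP <-; rewrite setU11.
  rewrite setD1K// eqxx andbT (cardsD1 v S) vS add1n.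
  by case: (D S); rewrite ?andbF ?andbT.
have oddL : odd (\sum_(T | door T) #|[set v | (v \notin T) && D (v |: T)]|).
  have dT0 : door T0 by rewrite /door cT0 eT0 !eqxx.
  rewrite (bigD1 T0)//= oddD oddT// eqxx.
  have -> // : odd (\sum_(T | door T && (T != T0))
      #|[set v | (v \notin T) && D (v |: T)]|) = false.
  apply: (big_ind (fun n => odd n = false)) => // [x y|T].
    by rewrite oddD => -> ->.
  by case/andP => /andP[/eqP cT /eqP eT] /negbTE TT0; rewrite oddT.
rewrite doubleE in oddL.
have [/existsP[S /and3P[DS /eqP cS /eqP eS]]|noS] :=
  boolP [exists S, [&& D S, #|S| == #|I| & c @: S == setT]]; first by exists S.
suff : odd (\sum_(S : {set Z} | D S && (#|S| == #|I|)) #|doors S|) = false.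
  by rewrite oddL.
apply: (big_ind (fun n => odd n = false)) => // [x y|S /andP[DS /eqP cS]].
  by rewrite oddD => -> ->.
rewrite odd_doors//; apply: contraNF noS => eS.
by apply/existsP; exists S; rewrite DS cS eS eqxx.
Qed.

End RainbowParity.

(** * Slack points and Scarf's lemma *)

Section Scarf.
Context {X I : finType} (h : I -> X -> nat) (c : X -> I).
Hypothesis h_inj : forall i, injective (h i).

Let bound := \max_i \max_x h i x.

Let h_bound i x : h i x <= bound.
Proof. exact: leq_trans (leq_bigmax x) (leq_bigmax i). Qed.

(* The slack point [inr i] is the least element of the i-th order and lies above
   X in every other one. *)
Definition slack_rank (i : I) (z : X + I) : nat :=
  match z with
  | inl x => (h i x).+1
  | inr j => if j == i then 0 else bound.+2 + enum_rank j
  end.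

Definition slack_color (z : X + I) : I :=
  match z with inl x => c x | inr j => j end.

Let slack_inj i : injective (slack_rank i).
Proof.
move=> [x|j] [y|k] /=.
- by move=> [/h_inj ->].
- by case: eqP => // _; have := h_bound i x; lia.
- by case: eqP => // _; have := h_bound i y; lia.
- case: eqP => [->|_]; case: eqP => [->|_] // /addnI E.
  by congr inr; apply/enum_rank_inj/val_inj.
Qed.

Let lt_slack i j x : i != j -> slack_rank i (inl x) < slack_rank i (inr j).
Proof. by move=> /= /negbTE ij; rewrite eq_sym ij; have := h_bound i x; lia. Qed.

(** The slack points other than that of [i0] form the only door with an odd number of dominant
    one-point extensions, so parity yields a dominant set with all colours. Its slack points are
    then discarded. *)
Theorem scarf (x0 : X) : 1 < #|I| ->
  exists S : {set X}, forall y,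
    exists2 i, i \in c @: S & forall s, s \in S -> h i y <= h i s.
Proof.
move=> I1; have [i0 _] : exists i0 : I, true by case/card_gt0P: (ltnW I1) => i; exists i.
have slack0 i : slack_rank i (inr i) = 0 by rewrite /= eqxx.
pose T0 : {set X + I} := inr @: (~: [set i0]).
have inT0 z : reflect (exists2 i, i != i0 & z = inr i) (z \in T0).
  apply: (iffP imsetP) => -[i]; rewrite ?inE => ii0 ->; exists i => //.
  by rewrite !inE.
have cT0 : #|T0|.+1 = #|I|.
  rewrite card_imset; last by move=> ? ? [].
  by rewrite cardsCs setCK cards1 subn1 prednK// ltnW.
have colT0 : slack_color @: T0 = ~: [set i0].
  by rewrite -imset_comp -[RHS]imset_id.
have dT0 : dominant slack_rank T0.
  apply/dominantP => -[x|j]; last by exists j => s; rewrite slack0.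
  by exists i0 => s /inT0[i ii0 ->]; rewrite ltnW// lt_slack// eq_sym.
have [S [dS cS colS]] : exists S, [/\ dominant slack_rank S, #|S| = #|I| &
    slack_color @: S = setT].
  apply: (rainbow_cell cT0 colT0) => T cT colT.
  have [dT|ndT] := boolP (dominant slack_rank T); last first.
    rewrite (_ : [set v | _] = set0) ?cards0.
      by apply/esym; apply: contraNF ndT => /eqP ->.
    apply/setP => v; rewrite !inE; apply: contraNF ndT => /andP[_].
    by apply: dominant_sub; apply: subsetUr.
  have T_neq0 : T != set0 by rewrite -card_gt0 -ltnS cT.
  have [m mT] := min_exists slack_rank T_neq0.
  have [a [b [ab mab ->]]] := dominant_extensions slack_inj T_neq0 dT cT mT.
  have [E|TT0] := eqVneq T T0.
    (* In [T0] each slack point is the minimum of its own order, so all of [X] lies beyond [m] for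
       [i0]. If [inr k] is the shared minimum, nothing lies beyond [m] for [k]: in order [i0] only
       slack points exceed [inr k], and each is least in its own order. *)
    have mE i : i != i0 -> m i = inr i.
      move=> ii0; apply: (@slack_inj i); apply/eqP.
      rewrite slack0 -leqn0 -(slack0 i) (mT i).2// E.
      by apply/inT0; exists i.
    have bey0 : beyond slack_rank m i0 != set0.
      by apply/set0Pn; exists (inl x0); apply/beyondP => i ii0; rewrite mE// slack0.
    have beyk k : k != i0 -> m i0 = inr k -> beyond slack_rank m k = set0.
      move=> ki0 mk; apply/setP => z; rewrite in_set0; apply/negP => /beyondP zM.
      have := zM i0; rewrite eq_sym mk ltnNge => /(_ ki0).
      case: z zM => [x _|j zM]; first by rewrite ltnW// lt_slack// eq_sym.
      have [->|jk] := eqVneq j k; first by rewrite leqnn.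
      by have := zM _ jk; rewrite slack0.
    have [ai0|ai0] := eqVneq a i0.
      rewrite -ai0 in beyk bey0; rewrite bey0 beyk ?eqxx// 1?eq_sym//.
      by rewrite mab mE// -ai0 eq_sym.
    have [bi0|bi0] := eqVneq b i0.
      by rewrite -bi0 in beyk bey0; rewrite bey0 beyk ?eqxx// -mab mE// -bi0.
    by move: mab ab; rewrite !mE// => -[->]; rewrite eqxx.
  (* A door made of slack points only is determined by its colours, hence equal to [T0]. Once [T]
     meets [X], each slack point [inr a'] exceeds the minima of all orders but [a'], so both sets
     are non-empty. *)
  have [x xT] : exists x, inl x \in T.
    apply/existsP; apply: contraNT TT0; rewrite negb_exists => /forallP xT.
    apply/eqP/setP => -[x|j].
      by rewrite (negbTE (xT x)); apply/esym/negbTE/negP => /inT0[].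
    apply/idP/inT0 => [jT|[k ki0 [->]]].
      exists j => //; have : slack_color (inr j) \in slack_color @: T by apply: imset_f.
      by rewrite colT !inE.
    have /imsetP[[y|l] lT kl] : k \in slack_color @: T by rewrite colT !inE.
      by rewrite (negbTE (xT y)) in lT.
    by rewrite kl.
  have bey a' : beyond slack_rank m a' != set0.
    apply/set0Pn; exists (inr a'); apply/beyondP => i ia.
    apply: leq_ltn_trans ((mT i).2 _ xT) _; exact: lt_slack.
  by rewrite !bey.
exists [set x | inl x \in S] => y.
have [i iS] := dominantP _ _ dS (inl y).
exists i; last by move=> s; rewrite inE => /iS.
(* The colour [i] cannot come from [inr i], which has rank 0 in order [i], since [inl y] has
   positive rank. *)
have /imsetP[[x|j] zS ij] : i \in slack_color @: S by rewrite colS inE.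
  by rewrite ij; apply: imset_f; rewrite inE.
by have := iS _ zS; rewrite ij /= eqxx.
Qed.
End Scarf.

(** * Integer points of the simplex *)

Lemma leq_term_sum (I : finType) (F : I -> nat) i : F i <= \sum_j F j.
Proof. by rewrite (bigD1 i)//= leq_addr. Qed.

(* An integer point [a] of the simplex [\sum_i a i = N] stands for [a / N]. *)
Lemma simplex_grid (I : finType) (N : nat) (c : {ffun I -> nat} -> I) :
    1 < #|I| ->
  exists2 s0 : {ffun I -> nat}, \sum_i s0 i = N &
  forall i, s0 i <= #|I| \/ exists s : {ffun I -> nat},
    [/\ \sum_i s i = N, c s = i &
        forall j, s j <= s0 j + #|I| /\ s0 j <= s j + #|I|].
Proof.
move=> I1; pose X : finType := {a : {ffun I -> 'I_N.+1} | \sum_i a i == N}.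
pose u (x : X) : {ffun I -> nat} := [ffun i => val x i : nat].
have sum_u x : \sum_i u x i = N.
  by rewrite -[RHS](eqP (valP x)); apply: eq_bigr => i _; rewrite ffunE.
have uP (g : I -> nat) : \sum_i g i = N -> exists x, forall i, u x i = g i.
  move=> gN; have gle i : g i < N.+1 by rewrite ltnS -gN leq_term_sum.
  have gE : \sum_i [ffun i => Ordinal (gle i)] i == N.
    by apply/eqP; rewrite -[RHS]gN; apply: eq_bigr => i _; rewrite ffunE.
  by exists (exist (fun a : {ffun I -> 'I_N.+1} => \sum_i a i == N) _ gE) => i; rewrite !ffunE.
(* Points are ordered by their i-th coordinate; the enumeration rank only breaks ties. *)
pose h i x := u x i * #|X| + enum_rank x.
have h_inj i : injective (h i).
  move=> x y /(congr1 (modn^~ #|X|)); rewrite !modnMDl !modn_small//.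
  by move=> /val_inj/enum_rank_inj.
have h_le i x y : h i x <= h i y -> u x i <= u y i.
  apply: contraTT; rewrite -!ltnNge /h => xy.
  apply: leq_trans (leq_addr _ _); apply: (@leq_trans ((u y i).+1 * #|X|)).
    by rewrite mulSnr ltn_add2l.
  by rewrite leq_mul2r xy orbT.
have [i0 _] : exists i0 : I, true by case/card_gt0P: (ltnW I1) => i; exists i.
have [x0 _] : exists x : X, forall i, u x i = if i == i0 then N else 0.
  by apply: uP; rewrite -big_mkcond big_pred1_eq.
have [S SP] := scarf (c \o u) h_inj x0 I1.
pose C := (c \o u) @: S.
have [i1 i1C _] := SP x0.
have /imsetP[s1 s1S _] := i1C.
pose m i := u [arg min_(x < s1 in S) u x i] i.
have mle i s : s \in S -> m i <= u s i.
  by rewrite /m; case: arg_minnP => // x _ xmin; apply: xmin.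
have mex i : exists2 s, s \in S & m i = u s i.
  by rewrite /m; case: arg_minnP => // x xS _; exists x.
pose L i := if i \in C then m i else 0.
(* Otherwise all minima [m i] with [i] in [C] could be raised by one, at a cost of at most [#|I|],
   within the total [N]; a grid point above the raised values contradicts Scarf's lemma. *)
have sumL : N <= \sum_i L i + #|I|.
  rewrite leqNgt; apply/negP => LN.
  pose g i := if i \in C then (m i).+1 else 0.
  have gN : \sum_i g i <= N.
    rewrite (leq_trans _ (ltnW LN))// -sum1_card -big_split/=.
    by apply: leq_sum => i _; rewrite /g /L; case: ifP; lia.
  have [y yE] : exists y : X, forall i,
      u y i = g i + (if i == i1 then N - \sum_i g i else 0).
    by apply: uP; rewrite big_split/= -[X in _ + X]big_mkcond big_pred1_eq subnKC.
  have [i iC iy] := SP y; have [s sS ms] := mex i.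
  by have := h_le _ _ _ (iy _ sS); rewrite yE -ms /g iC; lia.
(* The points of [S] lie above [L] and have sum [N], which leaves an excess of at most [#|I|].
   Colours outside [C] have [L i = 0], whence the first alternative. *)
have near s j : s \in S -> L j <= u s j <= L j + #|I|.
  move=> sS; have Lle i : L i <= u s i by rewrite /L; case: ifP => // _; apply: mle.
  rewrite Lle -leq_subLR (leq_trans (leq_term_sum (fun i => u s i - L i) j))//.
  by rewrite sumnB// sum_u leq_subLR.
exists (u s1) => // i; have [iC|iC] := boolP (i \in C); last first.
  by left; have := near _ i s1S; rewrite /L (negbTE iC) => /andP[].
right; have /imsetP[s sS ->] := iC; exists (u s); split=> // j.
by have := near _ j s1S; have := near _ j sS; lia.
Qed.

From mathcomp Require Import all_classical all_reals all_analysis.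
From mathcomp Require Import ring lra.

Import Order.TTheory GRing.Theory Num.Theory.
Import numFieldNormedType.Exports.

Local Open Scope classical_set_scope.
Local Open Scope ring_scope.

(** * The fixed point theorems of Brouwer and Schauder *)

Lemma compact_cluster_seq (R : realType) (V : normedModType R) (A : set V)
    (u : nat -> V) : compact A -> (forall n, A (u n)) ->
  exists2 p, A p & forall e, 0 < e -> forall N, exists2 n, (N <= n)%N & `|p - u n| < e.
Proof.
move=> cA Au; have uA : \forall n \near \oo, A (u n) by exact: nearW.
have [p [Ap clp]] := cA (u @ \oo) _ uA.
exists p => // e e0 N.
have [] := clp (u @` [set n | (N <= n)%N]) (ball p e).
- by exists N => // n /= Nn; exists n.
- exact: nbhsx_ballx.
- by move=> _ [[n Nn <-]]; rewrite -ball_normE /= => ?; exists n.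
Qed.

Lemma continuous_sum (R : numFieldType) (T : topologicalType) (V : normedModType R)
    (J : Type) (r : seq J) (P : pred J) (F : J -> T -> V) :
  (forall j, continuous (F j)) -> continuous (fun x => \sum_(j <- r | P j) F j x).
Proof.
move=> cF; elim: r => [|j r IH].
  rewrite (_ : (fun x => _) = cst 0); first exact: cst_continuous.
  by apply/funext => x; rewrite big_nil.
have [Pj|Pj] := boolP (P j); last first.
  by under eq_fun do rewrite big_cons (negbTE Pj).
under eq_fun do rewrite big_cons Pj.
by move=> x; apply: continuousD; [exact: cF|exact: IH].
Qed.

Lemma rV_norm_coord (R : realType) n (x : 'rV[R]_n) i : `|x 0 i| <= `|x|.
Proof. by rewrite [leRHS]mx_normrE; apply: (le_bigmax _ _ (0, i)). Qed.

Lemma rV_norm_le (R : realType) n (x : 'rV[R]_n) e :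
  0 <= e -> (forall i, `|x 0 i| <= e) -> `|x| <= e.
Proof.
move=> e0 xe; rewrite [leLHS]mx_normrE; apply/bigmax_leP; split=> // -[i j] _ /=.
by rewrite ord1.
Qed.

Lemma closed_ball_rV_compact (R : realType) n (r : R) :
  compact [set x : 'rV[R]_n | `|x| <= r].
Proof.
apply: bounded_closed_compact.
  by exists r; split; rewrite ?num_real// => M rM x /= /le_trans; apply; exact: ltW.
have /continuous_closedP/(_ _ (@closed_le R r)) := @norm_continuous _ 'rV[R]_n.
by [].
Qed.

Lemma near_lt (R : realType) (T : topologicalType) (f g : T -> R) x :
  {for x, continuous f} -> {for x, continuous g} -> f x < g x ->
  \forall y \near x, f y < g y.
Proof.
move=> cf cg; rewrite -subr_gt0 => fg.
have : (g y - f y) @[y --> x] --> (g x - f x) by exact: cvgB.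
move=> /cvgrPdist_lt /(_ _ fg); apply: filterS => y.
by rewrite ltr_norml => /andP[_]; rewrite ltrBlDr ltrDl subr_gt0.
Qed.

Lemma natr_div_small (R : realType) (c e : R) : 0 < e ->
  exists N0, forall N, (N0 <= N)%N -> c / N.+1%:R < e.
Proof.
move=> e0; exists (Num.bound (c / e)) => N leN.
rewrite ltr_pdivrMr ?ltr0n// -ltr_pdivrMl// mulrC.
have [ce|ce] := leP 0 (c / e); last by rewrite (lt_le_trans ce).
by rewrite (lt_le_trans (archi_boundP ce))// ler_nat ltnW.
Qed.

(* Each grid vertex is coloured by a coordinate that F does not decrease; by
   Scarf's lemma some small set of grid points carries every colour that matters. *)
Lemma simplex_grid_real (R : realType) m (F : 'rV[R]_m.+2 -> 'rV[R]_m.+2) N :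
  (forall t i, 0 <= F t 0 i) -> (forall t, \sum_i F t 0 i = 1) ->
  exists t : 'rV[R]_m.+2, [/\ forall i, 0 <= t 0 i, \sum_i t 0 i = 1 &
    forall i, t 0 i <= m.+2%:R / N.+1%:R \/
      exists2 s : 'rV[R]_m.+2, s 0 i <= F s 0 i & `|t - s| <= m.+2%:R / N.+1%:R].
Proof.
move=> F0 F1.
pose pt (a : {ffun 'I_m.+2 -> nat}) : 'rV[R]_m.+2 := \row_i ((a i)%:R / N.+1%:R).
have pt1 (a : {ffun 'I_m.+2 -> nat}) : (\sum_i a i)%N = N.+1 -> \sum_i pt a 0 i = 1.
  move=> aN; under eq_bigr do rewrite mxE.
  by rewrite -mulr_suml -natr_sum aN divff.
(* Both points have coordinate sum 1, so not all coordinates can decrease; off the grid the colour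
   is arbitrary. *)
have /choice[c cP] : forall a : {ffun 'I_m.+2 -> nat}, exists i,
    (\sum_i a i)%N = N.+1 -> pt a 0 i <= F (pt a) 0 i.
  move=> a; apply: contrapT => /forallNP noi.
  have /not_implyP[aN _] := noi 0.
  suff : \sum_i F (pt a) 0 i < \sum_i pt a 0 i by rewrite F1 pt1// ltxx.
  have lt i : F (pt a) 0 i < pt a 0 i.
    by have /not_implyP[_ /negP] := noi i; rewrite -ltNge.
  by apply: ltr_sum => //; apply/hasP; exists 0; rewrite ?mem_index_enum.
have [|s0 s0N s0P] := @simplex_grid _ N.+1 c; first by rewrite card_ord.
exists (pt s0); split=> [i||i]; [by rewrite mxE divr_ge0|exact: pt1|].
have := s0P i; rewrite card_ord => -[le|[s [sN <- near]]]; [left|right].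
  by rewrite mxE ler_pM2r ?invr_gt0// ler_nat.
exists (pt s); first exact: cP.
apply: rV_norm_le => [|j]; first by rewrite divr_ge0.
rewrite !mxE -mulrBl normrM [X in _ * X]gtr0_norm ?invr_gt0//.
rewrite ler_pM2r ?invr_gt0// ler_distl -natrD ler_nat (near j).2 lerBlDr -natrD.
by rewrite ler_nat (near j).1.
Qed.

(** At a cluster point [p] of the grid solutions no coordinate decreases: a strict decrease would
    persist near [p] and force [0 < p 0 i], excluding both alternatives on fine grids. Comparing
    coordinate sums gives equality. *)
Lemma brouwer_simplex (R : realType) m (F : 'rV[R]_m.+2 -> 'rV[R]_m.+2) :
  continuous F -> (forall t i, 0 <= F t 0 i) -> (forall t, \sum_i F t 0 i = 1) ->
  exists t, F t = t.
Proof.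
move=> cF F0 F1.
have /choice[t tP] := fun N => simplex_grid_real N F0 F1.
have [p clp] : exists p : 'rV[R]_m.+2, forall e : R, 0 < e -> forall N,
    exists2 n, (N <= n)%N & `|p - t n| < e.
  have [N|p _ clp] :=
    @compact_cluster_seq _ _ _ t (@closed_ball_rV_compact R m.+2 1); last first.
    by exists p.
  have [t0 t1 _] := tP N; apply: rV_norm_le => // i.
  by rewrite ger0_norm// -t1 (bigD1 i)//= lerDl sumr_ge0.
have p1 : 1 <= \sum_i p 0 i.
  rewrite leNgt; apply/negP => p1.
  have /nbhs_ballP[e /= e0 eP] : \forall y \near p, \sum_i (y : 'rV[R]_m.+2) 0 i < 1.
    apply: near_lt p1; last exact: cst_continuous.
    by apply: continuous_sum => i; exact: coord_continuous.
  have [N _ pN] := clp e e0 0; have [_ tN1 _] := tP N.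
  by have := eP (t N); rewrite -ball_normE /= tN1 ltxx => /(_ pN).
have pF i : p 0 i <= F p 0 i.
  rewrite leNgt; apply/negP => Fp.
  have /nbhs_ballP[d /= d0 dP] : \forall y \near p, F y 0 i < (y : 'rV[R]_m.+2) 0 i.
    apply: near_lt Fp; last exact: coord_continuous.
    apply: (@continuous_comp _ _ _ F (fun M : 'rV[R]_m.+2 => M 0 i)).
      exact: cF.
    exact: coord_continuous.
  have pi0 : 0 < p 0 i by apply: le_lt_trans Fp.
  have [e [e0 ed ep]] : exists e : R, [/\ 0 < e, e + e <= d & e + e <= p 0 i].
    exists (Num.min d (p 0 i) / 2); rewrite -splitr !ge_min !lexx orbT.
    by rewrite divr_gt0// lt_min d0.
  have [N0 N0P] := natr_div_small m.+2%:R e0.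
  have [N /N0P Ne pN] := clp e e0 N0.
  have [_ _ /(_ i)[tNi|[s sF ts]]] := tP N.
    have := le_lt_trans (rV_norm_coord (p - t N) i) pN.
    by rewrite !mxE ltr_distl => /andP[_]; have := le_lt_trans tNi Ne; lra.
  have : F s 0 i < s 0 i.
    apply: dP; rewrite -ball_normE /=; rewrite (_ : p - s = p - t N + (t N - s)).
      rewrite (le_lt_trans (ler_normD _ _))// (lt_le_trans _ ed)// ltrD//.
      exact: le_lt_trans ts Ne.
    by rewrite addrA subrK.
  by rewrite ltNge sF.
exists p; apply/rowP => i; apply/eqP; rewrite -subr_eq0.
have Fp0 : \sum_i (F p 0 i - p 0 i) = 0.
  apply/eqP; rewrite eq_le sumr_ge0 ?andbT; last by move=> j _; rewrite subr_ge0.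
  by rewrite sumrB F1 subr_le0.
by rewrite (psumr_eq0P _ Fp0)// => j _; rewrite subr_ge0.
Qed.

(** * From Brouwer to Schauder *)

(** The index type fits [brouwer_simplex], whose simplices have at least two vertices; surplus
    indices repeat [x0]. *)
Lemma compact_net (R : realType) (V : normedModType R) (A : set V) (e : R) :
  compact A -> A !=set0 -> 0 < e ->
  exists m (y : 'I_m.+2 -> V), (forall i, A (y i)) /\
    forall x, A x -> exists i, `|x - y i| < e.
Proof.
move=> cA [x0 Ax0] e0; move: cA; rewrite compact_cover.
move=> /(_ V A (fun y => ball y e)) [|x Ax|D DA AD].
- by move=> y _; exact: ball_open.
- by exists x => //; exact: ballxx.
pose s := finmap.enum_fset D; exists (size s), (fun i => nth x0 s i); split=> [i|x /AD].
  have [lt|ge] := ltnP i (size s); last by rewrite nth_default.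
  exact/set_mem/DA/mem_nth.
move=> [y /= yD]; rewrite -ball_normE /= distrC => xy.
have ys : (index y s < (size s).+2)%N by rewrite ltnS ltnW// ltnS index_size.
by exists (Ordinal ys); rewrite /= nth_index.
Qed.

Lemma normalize_weights (R : realType) (T : topologicalType) (I : finType)
    (w : I -> T -> R) :
  (forall i, continuous (w i)) -> (forall i x, 0 <= w i x) ->
  (forall x, exists i, 0 < w i x) ->
  exists a : I -> T -> R, [/\ forall i, continuous (a i),
    forall i x, 0 <= a i x, forall x, \sum_i a i x = 1 &
    forall i x, 0 < a i x -> 0 < w i x].
Proof.
move=> cw w0 wex; pose W x := \sum_i w i x.
have W0 x : 0 < W x.
  by have [i wi] := wex x; rewrite /W (bigD1 i)//= ltr_pwDl// sumr_ge0.
have Wn0 x : W x != 0 by rewrite gt_eqF.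
exists (fun i x => w i x / W x); split=> [i x|i x|x|i x].
- apply: (@continuousM _ _ (w i) (fun y => (W y)^-1)); first exact: cw.
  by apply: continuousV => //; exact: continuous_sum.
- by rewrite divr_ge0// ltW.
- by rewrite -mulr_suml divff//; exact: Wn0.
- by rewrite pmulr_lgt0 ?invr_gt0.
Qed.

Lemma dist_average (R : realType) (V : normedModType R) (I : finType)
    (a : I -> R) (y z : I -> V) (e : R) :
  (forall i, 0 <= a i) -> \sum_i a i = 1 ->
  (forall i, 0 < a i -> `|y i - z i| <= e) ->
  `|\sum_i a i *: y i - \sum_i a i *: z i| <= e.
Proof.
move=> a0 a1 yz; rewrite -sumrB (le_trans (ler_norm_sum _ _ _))//.
rewrite -[leRHS]mul1r -a1 mulr_suml; apply: ler_sum => i _.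
rewrite -scalerBr normrZ ger0_norm//.
have := a0 i; rewrite le_eqVlt => /predU1P[<-|ai]; first by rewrite !mul0r.
by rewrite ler_wpM2l// yz.
Qed.

Lemma rV_continuous (R : realType) (T : topologicalType) n (f : T -> 'rV[R]_n) :
  (forall i, continuous (fun x => f x 0 i)) -> continuous f.
Proof.
move=> cf x; apply/cvgrPdist_le => e e0.
have : \forall y \near x, forall i, `|f x 0 i - f y 0 i| <= e.
  apply: filter_forall => i.
  by have /cvgrPdist_le/(_ _ e0) := cf i x.
apply: filterS => y fy; apply: rV_norm_le; first exact: ltW.
by move=> i; rewrite !mxE.
Qed.

Lemma continuous_norm_sub (R : realType) (V : normedModType R) (y : V) :
  continuous (fun x : V => `|x - y|).
Proof.
move=> x; apply: (@continuous_comp _ _ _ (fun z => z - y) (fun z => `|z|)).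
  by apply: cvgB; [exact: cvg_id|exact: cvg_cst].
exact: norm_continuous.
Qed.

(** Weights supported on the net points close to [g (comb t)] define a map into the simplex. When
    they reproduce [t], the point [comb t] is an average of net points within [e] of
    [g (comb t)]. *)
Lemma almost_fixed_point (R : realType) (V : normedModType R) (A : set V)
    (g : V -> V) (e : R) :
  continuous g -> compact A -> (forall x, A (g x)) -> 0 < e ->
  exists x, `|g x - x| <= e.
Proof.
move=> cg cA gA e0.
have [m [y [_ netP]]] := compact_net cA (ex_intro _ _ (gA 0)) e0.
pose comb (t : 'rV[R]_m.+2) := \sum_i t 0 i *: y i.
have cc : continuous comb.
  apply: continuous_sum => i x.
  by apply: continuousZ; [exact: coord_continuous|exact: cst_continuous].
pose w i (t : 'rV[R]_m.+2) := Num.max 0 (e - `|g (comb t) - y i|).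
have w_gt0 i t : (0 < w i t) = (`|g (comb t) - y i| < e).
  by rewrite lt_max ltxx subr_gt0.
have cgc : continuous (g \o comb).
  by move=> t; apply: continuous_comp; [exact: cc|exact: cg].
have cd i : continuous (fun t => `|g (comb t) - y i|).
  move=> t; apply: (@continuous_comp _ _ _ (g \o comb) (fun z => `|z - y i|)).
    exact: cgc.
  exact: continuous_norm_sub.
have [|i t|t|a [ca a0 a1 aw]] := @normalize_weights _ _ _ w.
- move=> i; apply: (@max_fun_continuous _ _ R (cst 0)); first exact: cst_continuous.
  by move=> t; exact: (cvgB (cvg_cst e) (cd i t)).
- by rewrite le_max lexx.
- by have [i iP] := netP _ (gA (comb t)); exists i; rewrite w_gt0.
have [||t|t tE] := @brouwer_simplex R m (fun t => \row_i a i t).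
- by apply: rV_continuous => i; under eq_fun do rewrite mxE; exact: ca.
- by move=> t i; rewrite mxE.
- by under eq_bigr do rewrite mxE.
exists (comb t); have {2}-> : comb t = \sum_i a i t *: y i.
  by apply: eq_bigr => i _; rewrite -{1}tE mxE.
rewrite -[g (comb t)]scale1r -(a1 t) scaler_suml; apply: dist_average => // i ai.
by rewrite ltW// -w_gt0 aw.
Qed.

Theorem schauder (R : realType) (V : normedModType R) (A : set V) (g : V -> V) :
  continuous g -> compact A -> (forall x, A (g x)) -> exists x, g x = x.
Proof.
move=> cg cA gA.
have /choice[u uP] : forall k, exists x, `|g x - x| <= k.+1%:R^-1.
  by move=> k; apply: (almost_fixed_point cg cA gA); rewrite invr_gt0.
(* The images are made to cluster, since the [u k] need not lie in [A]; along the same indices the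
   [u k] approach [p] too. *)
have [p _ clp] := @compact_cluster_seq _ _ _ (g \o u) cA (fun k => gA (u k)).
exists p; apply/eqP; rewrite -subr_eq0 -normr_le0; apply/ler_addgt0Pr => e e0.
rewrite add0r; have e2 : 0 < e / 2 by rewrite divr_gt0.
have /cvgrPdist_lt/(_ _ e2)/nbhs_ballP[d /= d0 dP] := cg p.
have [f [f0 fe fd]] : exists f : R, [/\ 0 < f, f <= e / 2 & f + f <= d].
  exists (Num.min (e / 2) (d / 2)); rewrite lt_min ge_min lexx e2 divr_gt0//.
  by split=> //; rewrite [leRHS]splitr lerD// ge_min lexx orbT.
have [N0 N0P] := natr_div_small 1 f0.
have [k /N0P kf pk] := clp f f0 N0; rewrite mul1r in kf.
have /dP gpk : ball p d (u k).
  rewrite -ball_normE /= (lt_le_trans _ fd)//.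
  rewrite (_ : p - u k = (p - g (u k)) + (g (u k) - u k)); last by rewrite addrA subrK.
  by rewrite (le_lt_trans (ler_normD _ _))// ltrD// (le_lt_trans (uP k)).
rewrite (_ : g p - p = (g p - g (u k)) - (p - g (u k))); last by rewrite opprB addrA subrK.
rewrite (le_trans (ler_normB _ _))// [leRHS]splitr lerD//; first exact: ltW.
exact: le_trans (ltW pk) fe.
Qed.

(** * Continuous selections *)

Lemma convex_setE (R : realType) (V : lmodType R) (A : set V) (x y : V) (t : R) :
  convex_set A -> A x -> A y -> 0 <= t -> t <= 1 -> A (t *: x + (1 - t) *: y).
Proof.
move=> cA Ax Ay t0 t1; apply/set_mem.
exact: (cA x y (Itv01 t0 t1) (mem_set Ax) (mem_set Ay)).
Qed.

Lemma convex_set_sum (R : realType) (V : lmodType R) (A : set V) (I : finType)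
    (a : I -> R) (z : I -> V) :
  convex_set A -> (forall i, 0 <= a i) -> \sum_i a i = 1 ->
  (forall i, 0 < a i -> A (z i)) -> A (\sum_i a i *: z i).
Proof.
move=> cA a0 a1 Az.
(* Partial sums are divided by their total weight, so that each is itself a convex combination. *)
suff H (r : seq I) : 0 < \sum_(i <- r) a i ->
    A ((\sum_(i <- r) a i)^-1 *: \sum_(i <- r) a i *: z i).
  by have := H (index_enum I); rewrite a1 invr1 scale1r; apply.
elim: r => [|i r IH]; first by rewrite big_nil ltxx.
rewrite !big_cons; set S := \sum_(j <- r) a j in IH *.
have S0 : 0 <= S by exact: sumr_ge0.
have := a0 i; rewrite le_eqVlt => /predU1P[<-|ai]; first by rewrite add0r scale0r add0r.
move=> _; have aS : 0 < a i + S by rewrite ltr_wpDr.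
have aSn0 : a i + S != 0 by rewrite gt_eqF.
move: S0; rewrite le_eqVlt => /predU1P[S0|S0].
  have -> : \sum_(j <- r) a j *: z j = 0.
    rewrite big_seq big1// => j jr.
    have : a j <= S by rewrite /S (big_rem j)//= lerDl sumr_ge0.
    by rewrite -S0 => aj; rewrite (_ : a j = 0) ?scale0r//; apply/le_anti; rewrite aj a0.
  by rewrite -S0 !addr0 scalerA mulVf ?gt_eqF// scale1r; exact: Az.
have := @convex_setE _ _ A (z i) _ (a i / (a i + S)) cA (Az _ ai) (IH S0).
have -> : 1 - a i / (a i + S) = S / (a i + S) by rewrite -{1}(divff aSn0) -mulrBl addrC addKr.
rewrite scalerDr !scalerA mulrAC divff ?gt_eqF// mul1r mulrC; apply.
  by rewrite mulr_ge0// ?invr_ge0 ltW.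
by rewrite mulrC ler_pdivrMr// mul1r lerDl ltW.
Qed.

(** The distance to the complement works. Capping it at 1 keeps it finite when [A] is the whole
    space, and it is 1-Lipschitz. *)
Lemma open_radius (R : realType) (U : normedModType R) (A : set U) : open A ->
  exists d : U -> R, [/\ continuous d, forall x, 0 <= d x &
    forall x, 0 < d x <-> A x].
Proof.
move=> oA; pose E x := [set r : R | 0 <= r <= 1 /\ ball x r `<=` A].
have E0 x : E x 0 by split; rewrite ?lexx ?ler01// => y; rewrite -ball_normE /= normr_lt0.
have Eub x : has_ubound (E x) by exists 1 => r [/andP[]].
have Elip x y : sup (E x) <= sup (E y) + `|x - y|.
  apply: ge_sup; first by exists 0.
  move=> r [/andP[r0 r1] rA]; have [rxy|rxy] := leP r `|x - y|.
    by rewrite (le_trans rxy)// lerDr; apply: (ub_le_sup (Eub y)).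
  rewrite -lerBlDr; apply: (ub_le_sup (Eub y)); split.
    by rewrite subr_ge0 ltW//= lerBlDr ler_wpDr.
  move=> z; rewrite -ball_normE /= ltrBrDr => yz; apply: rA; rewrite -ball_normE /=.
  by rewrite (le_lt_trans (ler_distD y _ _))// addrC.
exists (fun x => sup (E x)); split=> [x|x|x].
- apply/cvgrPdist_le => e e0; apply/nbhs_ballP; exists e => //= y.
  rewrite -ball_normE /= => xy; rewrite ler_distl.
  apply/andP; split; last by rewrite (le_trans (Elip x y))// lerD2l ltW.
  by rewrite lerBlDr (le_trans (Elip y x))// lerD2l distrC ltW.
- exact: (ub_le_sup (Eub x)).
split=> [dx|Ax].
  apply: contrapT => nAx; suff : sup (E x) <= 0 by rewrite leNgt dx.
  apply: ge_sup; first by exists 0.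
  move=> r [_ rA]; rewrite leNgt; apply/negP => r0; apply/nAx/rA.
  exact: ballxx.
have /nbhs_ballP[r /= r0 rA] : nbhs x A by exact: open_nbhs_nbhs.
apply: (@lt_le_trans _ _ (Num.min r 1)); first by rewrite lt_min r0 ltr01.
apply: (ub_le_sup (Eub x)); split; first by rewrite le_min ltW//= ler01 ge_min lexx orbT.
apply: subset_trans rA; apply: le_ball.
by rewrite ge_min lexx.
Qed.

Lemma half_pow_small (R : realType) (c e : R) : 0 <= c -> 0 < e ->
  exists k, c * 2^-1 ^+ k < e.
Proof.
move=> c0 e0; have [N /(_ N (leqnn N)) b] := natr_div_small c e0.
exists N; apply: le_lt_trans b => //.
rewrite ler_wpM2l// exprVn lef_pV2 ?posrE ?exprn_gt0//.
by rewrite -natrX ler_nat ltn_expl.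
Qed.

(** Compactness of [B] takes the place of completeness: cluster points of [f k x] inherit the bounds
    of the telescoped geometric series, whose total is [c *+ 2]. *)
Lemma uniform_limit_compact (R : realType) (T : topologicalType) (V : normedModType R)
    (B : set V) (f : nat -> T -> V) (c : R) :
  compact B -> (forall k, continuous (f k)) -> (forall k x, B (f k x)) ->
  (forall k x, `|f k.+1 x - f k x| <= c * 2^-1 ^+ k) ->
  exists2 g : T -> V, continuous g & forall k x, `|g x - f k x| <= c *+ 2 * 2^-1 ^+ k.
Proof.
move=> cB cf fB fc.
have far k j x : `|f (k + j)%N x - f k x| <= c *+ 2 * (2^-1 ^+ k - 2^-1 ^+ (k + j)).
  elim: j => [|j IH]; first by rewrite addn0 !subrr normr0 mulr0.
  rewrite addnS -(subrK (f (k + j)%N x) (f (k + j).+1 x)) -addrA.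
  rewrite (le_trans (ler_normD _ _))// (le_trans (lerD (fc _ _) IH))// exprS.
  rewrite le_eqVlt; apply/predU1P; left.
  move: (2^-1 ^+ (k + j)) (2^-1 ^+ k) => a b.
  by rewrite -mulr_natl; field.
have /choice[g gP] : forall x, exists p, forall k, `|p - f k x| <= c *+ 2 * 2^-1 ^+ k.
  move=> x; have [p _ clp] := @compact_cluster_seq _ _ _ (f^~ x) cB (fB^~ x).
  exists p => k; apply/ler_addgt0Pr => e e0; have [n kn pn] := clp e e0 k.
  rewrite -(subrK (f n x) p) -addrA (le_trans (ler_normD _ _))//.
  rewrite [leRHS]addrC lerD ?(ltW pn)//.
  have c0 : 0 <= c.
    by have := le_trans (normr_ge0 _) (fc 0 x); rewrite expr0 mulr1.
  rewrite -(subnKC kn) (le_trans (far _ _ _))// ler_wpM2l ?mulrn_wge0//.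
  by rewrite gerBl exprn_ge0.
exists g => [x|//]; apply/cvgrPdist_lt => e e0.
have c0 : 0 <= c by have := le_trans (normr_ge0 _) (fc 0 x); rewrite expr0 mulr1.
have e3 : 0 < e / 3 by rewrite divr_gt0.
have [k kP] := half_pow_small (mulrn_wge0 2 c0) e3.
have /cvgrPdist_lt/(_ _ e3) := cf k x; apply: filterS => y xy.
have -> : g x - g y = (g x - f k x) + (f k x - f k y) + (f k y - g y).
  by rewrite !addrA !subrK.
have gx := le_lt_trans (gP x k) kP; have gy := le_lt_trans (gP y k) kP.
rewrite distrC in gy.
have -> : e = e / 3 + e / 3 + e / 3 by field.
by rewrite (le_lt_trans (ler_normD _ _))// ltrD// (le_lt_trans (ler_normD _ _))// ltrD.
Qed.

(* The neighbourhood form of [lower_semicontinuous_on], on the whole space. *)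
Definition lsc (R : realType) (U V : normedModType R) (Phi : U -> set V) :=
  forall x y e, Phi x y -> 0 < e ->
    \forall x' \near x, exists2 y', Phi x' y' & `|y - y'| < e.

Lemma lsc_open (R : realType) (U V : normedModType R) (Phi : U -> set V) (z : V)
    (r : R) : lsc Phi -> open [set x | exists2 y, Phi x y & `|z - y| < r].
Proof.
move=> lPhi; rewrite openE => x [y xy zy].
have e0 : 0 < r - `|z - y| by rewrite subr_gt0.
apply: filterS (lPhi x y _ xy e0) => x' [y' xy' yy']; exists y' => //.
rewrite -(subrK y z) -addrA (le_lt_trans (ler_normD _ _))//.
by rewrite -ltrBrDl.
Qed.

Lemma lsc_ball (R : realType) (U V : normedModType R) (Phi : U -> set V)
    (f : U -> V) (r : R) : lsc Phi -> continuous f ->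
  lsc (fun x => [set y | Phi x y /\ `|f x - y| < r]).
Proof.
move=> lPhi cf x y e [xy fy] e0.
have s0 : 0 < (r - `|f x - y|) / 2 by rewrite divr_gt0// subr_gt0.
have m0 : 0 < Num.min e ((r - `|f x - y|) / 2) by rewrite lt_min e0.
have /cvgrPdist_lt/(_ _ s0) := cf x.
apply: filterS2 (lPhi x y _ xy m0) => x' [y' xy'].
rewrite lt_min => /andP[yy' yy2] ff'; exists y' => //; split=> //.
have -> : f x' - y' = (f x' - f x) + ((f x - y) + (y - y')) by rewrite !addrA !subrK.
rewrite (le_lt_trans (ler_normD _ _))//.
rewrite (@le_lt_trans _ _ (`|f x' - f x| + (`|f x - y| + `|y - y'|)))//.
  by rewrite lerD2l ler_normD.
rewrite distrC; move: ff' yy2.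
by move: `|f x - f x'| `|f x - y| `|y - y'| => p q s; lra.
Qed.

Lemma convex_ball (R : realType) (V : normedModType R) (z : V) (r : R) :
  convex_set [set y : V | `|z - y| < r].
Proof.
move=> x y t /set_mem/= zx /set_mem/= zy; apply/mem_set => /=.
have -> : z - conv t x y = t%:num *: (z - x) + (1 - t%:num) *: (z - y).
  by rewrite !scalerBr addrACA -scalerDl [t%:num + _]addrC subrK scale1r -opprD.
set m := Num.max `|z - x| `|z - y|.
have mr : m < r by rewrite gt_max zx.
rewrite (le_lt_trans (ler_normD _ _))// !normrZ (le_lt_trans _ mr)//.
rewrite [leRHS](_ : _ = `|t%:num| * m + `|1 - t%:num| * m).
  by rewrite lerD// ler_wpM2l// le_max lexx ?orbT.
by rewrite -mulrDl !ger0_norm ?subr_ge0// addrC subrK mul1r.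
Qed.

(** Points outside the closed set [C] have neighbourhoods avoiding it. At points of [C], a value of
    [Psi] is also one of [Phi], so it is approximated on both sides. *)
Lemma lsc_glue (R : realType) (U V : normedModType R) (C : set U)
    (Phi Psi : U -> set V) : closed C -> lsc Phi ->
  (forall x y e, C x -> Psi x y -> 0 < e ->
    \forall x' \near x, C x' -> exists2 y', Psi x' y' & `|y - y'| < e) ->
  (forall x, C x -> Psi x `<=` Phi x) ->
  lsc (fun x => if x \in C then Psi x else Phi x).
Proof.
move=> cC lPhi lPsi sub x y e; have [/set_mem xC xy e0|/negP xC xy e0] := boolP (x \in C).
  have H := lPhi x y e (sub _ xC _ xy) e0.
  apply: filterS2 H (lPsi _ _ _ xC xy e0) => x' PhiP PsiP.
  by have [/set_mem/PsiP|_] := boolP (x' \in C).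
have : nbhs x (~` C).
  by apply: open_nbhs_nbhs; split; [exact: closed_openC|move=> /mem_set].
apply: filterS2 (lPhi _ _ _ xy e0) => x' PhiP nC.
by have [/set_mem|] := boolP (x' \in C).
Qed.

Lemma convex_closed_ball (R : realType) (V : normedModType R) (r : R) :
  convex_set [set y : V | `|y| <= r].
Proof.
move=> x y t /set_mem/= xr /set_mem/= yr; apply/mem_set => /=.
rewrite (le_trans (ler_normD _ _))// !normrZ.
rewrite [leRHS](_ : r = t%:num * r + (1 - t%:num) * r).
  by rewrite !ger0_norm ?subr_ge0// lerD// ler_wpM2l// subr_ge0.
by rewrite -mulrDl addrC subrK mul1r.
Qed.

Section Selection.
Context {R : realType} {U V : normedModType R} (B : set V).
Hypotheses (B_compact : compact B) (B_convex : convex_set B).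
Implicit Types (Phi : U -> set V).

Definition lsc_convex Phi := [/\ lsc Phi, forall x, Phi x !=set0,
  forall x, convex_set (Phi x) & forall x, Phi x `<=` B].

(** A partition of unity subordinate to the open sets where [Phi] comes within [e] of a net point
    averages the net points. *)
Lemma approximate_selection Phi e : lsc_convex Phi -> 0 < e ->
  exists f : U -> V, [/\ continuous f, forall x, B (f x) &
    forall x, exists2 y, Phi x y & `|f x - y| <= e].
Proof.
move=> [lPhi Phi0 cPhi PhiB] e0.
have B0 : B !=set0 by have [y /PhiB] := Phi0 0; exists y.
have [m [y [yB netP]]] := compact_net B_compact B0 e0.
have /choice[d dP] := fun i => open_radius (lsc_open (y i) e lPhi).
have [i|i x|x|a [ca a0 a1 ad]] := @normalize_weights _ _ _ d.
- by have [] := dP i.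
- by have [] := dP i.
- have [z xz] := Phi0 x; have [i zi] := netP z (PhiB _ _ xz); exists i.
  by have [_ _ dpos] := dP i; apply/dpos; exists z; rewrite // distrC.
exists (fun x => \sum_i a i x *: y i); split=> [|x|x].
- apply: continuous_sum => i x.
  by apply: continuousZ; [exact: ca|exact: cst_continuous].
- exact: convex_set_sum.
have /choice[z zP] : forall i, exists z, 0 < a i x -> Phi x z /\ `|y i - z| < e.
  move=> i; have [_ _ dpos] := dP i.
  have [ai|ai] := ltP 0 (a i x); last by exists 0.
  by have /dpos[z] := ad _ _ ai; exists z.
exists (\sum_i a i x *: z i).
  by apply: convex_set_sum => // i /zP[].
by apply: dist_average => // i /zP[_ /ltW].
Qed.

(* Michael's selection theorem, for the closures of the values. *)
Theorem closure_selection Phi : lsc_convex Phi ->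
  exists f : U -> V, [/\ continuous f, forall x, B (f x) &
    forall x, closure (Phi x) (f x)].
Proof.
move=> lcPhi; have [lPhi Phi0 cPhi PhiB] := lcPhi.
pose P k (f : U -> V) := [/\ continuous f, forall x, B (f x) &
  forall x, exists2 y, Phi x y & `|f x - y| < 2^-1 ^+ k].
have h0 k : 0 < 2^-1 ^+ k :> R by rewrite exprn_gt0.
(* The next approximation is made for [Phi x] cut down to the ball around [f x], which keeps it
   close to [f]. *)
have step k f : P k f -> exists2 f', P k.+1 f' &
    forall x, `|f' x - f x| <= 2 * 2^-1 ^+ k.
  move=> [cf fB fP].
  have e0 : 0 < 2^-1 ^+ k / 4 :> R by rewrite divr_gt0.
  have [|f' [cf' f'B f'P]] :=
      @approximate_selection (fun x => [set y | Phi x y /\ `|f x - y| < 2^-1 ^+ k]) _ _ e0.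
    split; [exact: lsc_ball|by move=> x; have [y] := fP x; exists y| |].
      move=> x y z t /set_mem[xy fy] /set_mem[xz fz]; apply/mem_set; split.
        by apply/set_mem; apply: cPhi; exact: mem_set.
      by apply/set_mem; apply: (@convex_ball _ _ (f x)); exact: mem_set.
    by move=> x y [/PhiB].
  exists f'.
    split=> // x; have [y [xy _] f'y] := f'P x; exists y => //.
    by rewrite (le_lt_trans f'y)// exprSr ltr_pM2l// ltf_pV2 ?posrE// ltr_nat.
  move=> x; have [y [xy fy] f'y] := f'P x.
  rewrite -(subrK y (f' x)) -addrA (le_trans (ler_normD _ _))//.
  rewrite mulr_natl mulr2n lerD//; last by rewrite distrC ltW.
  by rewrite (le_trans f'y)// ler_pdivrMr// ler_peMr ?ler1n// ltW.
have /choice[s sP] : forall kf : nat * (U -> V), exists f', P kf.1 kf.2 ->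
    P kf.1.+1 f' /\ forall x, `|f' x - kf.2 x| <= 2 * 2^-1 ^+ kf.1.
  move=> [k f]; have [Pf|nPf] := pselect (P k f); last by exists f.
  by have [f'] := step _ _ Pf; exists f'.
have [f0 Pf0] : exists f0, P 0 f0.
  have half0 : 0 < 2^-1 :> R by rewrite invr_gt0.
  have [f0 [cf0 f0B f0P]] := approximate_selection lcPhi half0.
  exists f0; split=> // x; have [y xy f0y] := f0P x; exists y => //.
  by rewrite expr0 (le_lt_trans f0y)// invf_lt1// ltr1n.
pose F := nat_rect (fun=> U -> V) f0 (fun k f => s (k, f)).
have FP k : P k (F k) by elim: k => // k IH; have [] := sP (k, F k) IH.
have [k|k x|k x|g cg gF] := @uniform_limit_compact _ _ _ _ F 2 B_compact.
- by have [] := FP k.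
- by have [] := FP k.
- by have [_] := sP (k, F k) (FP k); exact.
have gcl x : closure (Phi x) (g x).
  move=> A /nbhs_ballP[e /= e0 eA].
  (* In units of the k-th power of 1/2, the limit is within 4 of [F k], which is within 1 of
     [Phi]. *)
  have [|k ke] := @half_pow_small R 5 e _ e0; first exact: ler0n.
  have [_ _ /(_ x)[y xy Fy]] := FP k; exists y; split=> //; apply: eA.
  rewrite -ball_normE /= -(subrK (F k x) (g x)) -addrA.
  rewrite (le_lt_trans (ler_normD _ _))// (lt_trans _ ke)//.
  rewrite (_ : 5 = 2 *+ 2 + 1); last by rewrite -mulr_natl; ring.
  by rewrite mulrDl mul1r ler_ltD// gF.
exists g; split=> // x.
have /closure_id -> : closed B by apply: compact_closed => //; exact: norm_hausdorff.
exact: closure_subset (PhiB x) _ (gcl x).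
Qed.

End Selection.

(** * Dense families of selections *)

Lemma closed_le_continuous (R : realType) (T : topologicalType) (f g : T -> R) :
  continuous f -> continuous g -> closed [set x | f x <= g x].
Proof.
move=> cf cg x clx /=; rewrite leNgt; apply/negP => gf.
have [y [/= fg]] := clx _ (near_lt (cg x) (cf x) gf).
by rewrite /= ltNge fg.
Qed.

Lemma closure_le (R : realType) (T : topologicalType) (f g : T -> R) (A : set T) x :
  continuous f -> continuous g -> (forall y, A y -> f y <= g y) ->
  closure A x -> f x <= g x.
Proof.
by move=> cf cg fg Ax; apply: (closed_le_continuous cf cg); apply: closure_subset Ax.
Qed.

Section DenseSelections.
Context {R : realType} {U V : normedModType R} (B : set V).
Hypotheses (B_compact : compact B) (B_convex : convex_set B).
Variable Phi : U -> set V.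
Hypothesis Phi_lc : lsc_convex B Phi.

Definition closure_selects (f : U -> V) :=
  [/\ continuous f, forall x, B (f x) & forall x, closure (Phi x) (f x)].

(* The open set where Phi meets ball z r is exhausted by the closed sets on
   which its inner radius is at least 1/(j+1); on each of them Phi may be
   replaced by its trace on the ball. *)
Lemma local_selections (z : V) (r : R) :
  exists f : nat -> U -> V, (forall j, closure_selects (f j)) /\
    forall x y, Phi x y -> `|z - y| < r -> exists j, `|z - f j x| <= r.
Proof.
have [lPhi Phi0 cPhi PhiB] := Phi_lc.
have [d [cd d0 dP]] := open_radius (lsc_open z r lPhi).
have /choice[f fP] : forall j : nat, exists f, closure_selects f /\
    forall x, j.+1%:R^-1 <= d x -> `|z - f x| <= r.
  move=> j; pose C := [set x : U | j.+1%:R^-1 <= d x].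
  have cC : closed C by apply: closed_le_continuous => //; exact: cst_continuous.
  have CP x : C x -> exists2 y, Phi x y & `|z - y| < r.
    by move=> Cx; apply/dP; apply: lt_le_trans Cx; rewrite invr_gt0.
  pose Psi x := [set y | Phi x y /\ `|z - y| < r].
  pose Phi' x := if x \in C then Psi x else Phi x.
  have sub x : Phi' x `<=` Phi x by rewrite /Phi'; case: (x \in C) => // y [].
  have lPhi' : lsc_convex B Phi'.
    split=> [|x|x|x].
    - apply: lsc_glue => // [x y e _ xy e0|x _ y []//].
      have := lsc_ball lPhi (@cst_continuous _ _ z) xy e0.
      by apply: filterS => x' H _.
    - rewrite /Phi'; case: (boolP (x \in C)) => // /set_mem/CP[y xy zy].
      by exists y.
    - rewrite /Phi'; case: (x \in C) => // y y' t /set_mem[xy zy] /set_mem[xy' zy'].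
      apply/mem_set; split; apply/set_mem; first by apply: cPhi; exact: mem_set.
      by apply: (@convex_ball _ _ z); exact: mem_set.
    - exact: subset_trans (PhiB x).
  have [f [cf fB fcl]] := closure_selection B_compact B_convex lPhi'.
  exists f; split; first by split=> // x; exact: closure_subset (sub x) _ (fcl x).
  move=> x Cx; have cz : closed [set y : V | `|y - z| <= r].
    by apply: closed_le_continuous; [exact: continuous_norm_sub|exact: cst_continuous].
  rewrite distrC; apply: cz; apply: closure_subset (fcl x) => y.
  by rewrite /Phi' mem_set// => -[_ zy]; rewrite /= distrC ltW.
exists f; split=> [j|x y xy zy]; first by have [] := fP j.
have dx : 0 < d x by apply/dP; exists y.
have [j /(_ j (leqnn j))] := natr_div_small 1 dx.
by rewrite mul1r => /ltW jd; exists j; have [_] := fP j; exact.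
Qed.

(** The local selections are taken for balls of radius [1/(k+1)] around a net of [B] of that
    fineness, for every [k], and enumerated by a single index. *)
Lemma dense_selections : exists F : nat -> U -> V,
  (forall i, closure_selects (F i)) /\
  forall x y e, Phi x y -> 0 < e -> exists i, `|y - F i x| < e.
Proof.
have [lPhi Phi0 cPhi PhiB] := Phi_lc.
have B0 : B !=set0 by have [y /PhiB] := Phi0 0; exists y.
have /choice[Y YP] : forall k, exists Y : nat -> V, forall y, B y ->
    exists i, `|y - Y i| < k.+1%:R^-1.
  move=> k; have k0 : 0 < k.+1%:R^-1 :> R by rewrite invr_gt0.
  have [m [Y [_ YP]]] := compact_net B_compact B0 k0.
  exists (fun i => Y (inord i)) => y /YP[i yi].
  by exists i; rewrite inord_val.
have /choice[G GP] := fun ki : nat * nat => local_selections (Y ki.1 ki.2) ki.1.+1%:R^-1.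
pose F n := let: (ki, j) := odflt ((0, 0), 0)%N (unpickle n) in G ki j.
exists F; split=> [n|x y e xy e0].
  by rewrite /F; case: (odflt _ _) => ki j; have [] := GP ki.
have [k /(_ k (leqnn k)) ke] := natr_div_small 2 e0.
have [i yi] := YP k y (PhiB _ _ xy); rewrite distrC in yi.
have [_ /(_ x y xy yi)[j zj]] := GP (k, i).
exists (pickle ((k, i), j)); rewrite /F pickleK/= -(subrK (Y k i) y) -addrA.
rewrite (le_lt_trans (ler_normD _ _))// (lt_trans _ ke)// mulr_natl mulr2n.
by rewrite ltr_leD// distrC.
Qed.

End DenseSelections.

(** * Proper separation of convex sets *)

Section DotProduct.
Context {R : realType} {n : nat}.
Implicit Types p q x y : 'rV[R]_n.

Definition dot p x := \sum_i p 0 i * x 0 i.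

Lemma dotC p x : dot p x = dot x p.
Proof. by apply: eq_bigr => i _; rewrite mulrC. Qed.

Lemma dotDr p x y : dot p (x + y) = dot p x + dot p y.
Proof. by rewrite -big_split; apply: eq_bigr => i _; rewrite mxE mulrDr. Qed.

Lemma dotZr p a x : dot p (a *: x) = a * dot p x.
Proof. by rewrite mulr_sumr; apply: eq_bigr => i _; rewrite mxE mulrCA. Qed.

Lemma dotNr p x : dot p (- x) = - dot p x.
Proof. by rewrite -scaleN1r dotZr mulN1r. Qed.

Lemma dotBr p x y : dot p (x - y) = dot p x - dot p y.
Proof. by rewrite dotDr dotNr. Qed.

Lemma dot0r p : dot p 0 = 0.
Proof. by rewrite -[0](scale0r 0) dotZr mul0r. Qed.

Lemma dot_sumr p (J : Type) (r : seq J) (P : pred J) (F : J -> 'rV[R]_n) :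
  dot p (\sum_(j <- r | P j) F j) = \sum_(j <- r | P j) dot p (F j).
Proof. by apply: (big_morph (dot p)) => [x y|]; [exact: dotDr|exact: dot0r]. Qed.

Lemma dot_ge0 x : 0 <= dot x x.
Proof. by apply: sumr_ge0 => i _; rewrite -expr2 sqr_ge0. Qed.

Lemma dot_eq0 x : (dot x x == 0) = (x == 0).
Proof.
apply/eqP/eqP => [x0|->]; last by rewrite dot0r.
apply/rowP => i; rewrite mxE; apply/eqP; rewrite -[_ == 0]orbb -mulf_eq0.
by apply/eqP; apply: (psumr_eq0P _ x0) => // j _; rewrite -expr2 sqr_ge0.
Qed.

Lemma dot_bound p x : dot p x <= (\sum_i `|p 0 i|) * `|x|.
Proof.
rewrite mulr_suml; apply: ler_sum => i _.
by rewrite (le_trans (ler_norm _))// normrM ler_wpM2l// rV_norm_coord.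
Qed.

Lemma dot_continuous (T : topologicalType) (f g : T -> 'rV[R]_n) :
  continuous f -> continuous g -> continuous (fun t => dot (f t) (g t)).
Proof.
move=> cf cg; apply: continuous_sum => i t.
have coord (h : T -> 'rV[R]_n) : continuous h -> {for t, continuous (fun s => h s 0 i)}.
  move=> ch; apply: (@continuous_comp _ _ _ h (fun M : 'rV[R]_n => M 0 i)).
    exact: ch.
  exact: coord_continuous.
by apply: (@continuousM _ _ (fun s => f s 0 i) (fun s => g s 0 i)); exact: coord.
Qed.

End DotProduct.

Lemma simplex_compact (R : realType) m :
  compact [set t : 'rV[R]_m | (forall i, 0 <= t 0 i) /\ \sum_i t 0 i = 1].
Proof.
set A := [set t | _]; apply: (@subclosed_compact _ A _ _ (@closed_ball_rV_compact R m 1)).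
  have cs : continuous (fun t : 'rV[R]_m => \sum_i t 0 i).
    by apply: continuous_sum => i; exact: coord_continuous.
  have c_cst (a : R) : continuous (fun _ : 'rV[R]_m => a) by exact: cst_continuous.
  move=> t clt; split=> [i|].
    have ci : continuous (fun t : 'rV[R]_m => t 0 i) by exact: coord_continuous.
    apply: (closure_le (f := cst 0) (c_cst 0) ci _ clt).
    by move=> s [].
  apply/eqP; rewrite eq_le; apply/andP; split.
    apply: (closure_le (g := cst 1) cs (c_cst 1) _ clt).
    by move=> s [_ ->].
  apply: (closure_le (f := cst 1) (c_cst 1) cs _ clt).
  by move=> s [_ ->].
move=> t [t0 t1]; apply: rV_norm_le => // i.
by rewrite ger0_norm// -t1 (bigD1 i)//= lerDl sumr_ge0.
Qed.

(* [c] is the point of the convex hull of the [s i] closest to [g]. *)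
Lemma finite_separation (R : realType) n (S : set 'rV[R]_n) (g : 'rV[R]_n) m
    (s : 'I_m.+1 -> 'rV[R]_n) : convex_set S -> (forall i, S (s i)) ->
  exists2 c, S c & forall i, 0 <= dot (c - g) (s i - g).
Proof.
move=> cS Ss; pose A := [set t : 'rV[R]_m.+1 | (forall i, 0 <= t 0 i) /\ \sum_i t 0 i = 1].
pose comb (t : 'rV[R]_m.+1) := \sum_i t 0 i *: s i.
have A0 : A !=set0.
  exists (\row_i (i == 0)%:R); split=> [i|]; first by rewrite mxE ler0n.
  by under eq_bigr do rewrite mxE; rewrite (bigD1 0)//= big1 ?addr0// => i /negbTE ->.
have cc : continuous (fun t => comb t - g).
  have cc : continuous comb.
    apply: continuous_sum => i x.
    by apply: continuousZ; [exact: coord_continuous|exact: cst_continuous].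
  by move=> t; exact: (cvgB (cc t) (cvg_cst g)).
have [||t /set_mem[t0 t1] tmin] :=
    @compact_EVT_min _ R (fun t => dot (comb t - g) (comb t - g)) A A0.
- exact: simplex_compact.
- by apply: continuous_subspaceT; exact: dot_continuous.
have ct : S (comb t) by exact: convex_set_sum.
exists (comb t) => // j; set c := comb t - g.
pose w := s j - comb t.
suff cw : 0 <= dot c w.
  have -> : s j - g = w + c by rewrite /w /c addrA subrK.
  by rewrite dotDr addr_ge0// dot_ge0.
rewrite leNgt; apply/negP => cw.
(* Moving [comb t] by a fraction [l] towards [s j] stays in the hull, so the distance to [g] does
   not drop; the expanded inequality is divided by [l]. *)
have quad (l : R) : 0 < l -> l <= 1 -> 0 <= dot c w *+ 2 + l * dot w w.
  move=> l0 l1; pose t' := (1 - l) *: t + l *: \row_i (i == j)%:R.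
  have At' : A t'.
    split=> [i|]; first by rewrite !mxE addr_ge0// mulr_ge0// ?subr_ge0// ltW.
    under eq_bigr do rewrite !mxE.
    rewrite big_split/= -!mulr_sumr t1 (bigD1 j)//= eqxx big1 ?addr0; first by rewrite !mulr1 subrK.
    by move=> i /negbTE ->.
  have ct' : comb t' - g = c + l *: w.
    rewrite /comb; under eq_bigr do rewrite !mxE scalerDl.
    rewrite big_split/= [X in _ + X - g](_ : _ = l *: s j).
      under eq_bigr do rewrite -scalerA; rewrite -scaler_sumr -/(comb t).
      rewrite /w /c scalerBl scale1r scalerBr -!addrA; congr (_ + _).
      by rewrite addrCA [RHS]addrC -addrA.
    rewrite (bigD1 j)//= eqxx mulr1 big1 ?addr0// => i /negbTE ->.
    by rewrite mulr0 scale0r.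
  have := tmin t' (mem_set At'); rewrite -/c ct'; clearbody c w.
  rewrite dotDr dotZr [dot (c + _) c]dotC [dot (c + _) w]dotC !dotDr !dotZr.
  rewrite [dot w c]dotC -subr_ge0 => h.
  rewrite -(pmulr_rge0 _ l0) (le_trans h)//.
  by rewrite le_eqVlt; apply/predU1P; left; ring.
have ww : 0 <= dot w w by exact: dot_ge0.
pose l := Num.min 1 (- dot c w / (dot w w + 1)).
have l0 : 0 < l by rewrite lt_min ltr01 divr_gt0 ?oppr_gt0// ltr_wpDl.
have := quad l l0; rewrite ge_min lexx => /(_ isT); rewrite leNgt => /negP; apply.
have : l * (dot w w + 1) <= - dot c w.
  by rewrite -ler_pdivlMr ?ltr_wpDl// ge_min lexx orbT.
by rewrite mulrDr mulr1; move: (l * dot w w) => z; lra.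
Qed.

(* For finitely many points of S take the unit vector along [c - g] above; by
   compactness some unit vector u works for all of S. It annihilates the
   annihilator of S - g, so it is not constant on S. *)
Theorem proper_separation (R : realType) n (S : set 'rV[R]_n) (g : 'rV[R]_n) :
  convex_set S -> S !=set0 -> ~ S g ->
  exists p, (forall s, S s -> 0 <= dot p (s - g)) /\
            exists2 s, S s & 0 < dot p (s - g).
Proof.
move=> cS [s0 Ss0] nSg.
pose Ann (q : 'rV[R]_n) := forall s, S s -> dot q (s - g) = 0.
pose A := [set u : 'rV[R]_n | `|u| <= 1].
(* The last clause puts [u] in the span of [S - g] through closed conditions, as the compactness
   argument requires. *)
pose f (s : 'rV[R]_n) := [set u : 'rV[R]_n | [/\ `|u| <= 1, 1 <= `|u|,
  0 <= dot (s - g) u & forall q, Ann q -> dot q u = 0]].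
have cA : compact A := @closed_ball_rV_compact R n 1.
have cdot (q : 'rV[R]_n) : continuous (dot q).
  by apply: dot_continuous => [|x]; [exact: cst_continuous|exact: cvg_id].
have cf s : closed (f s).
  have c_cst (a : R) : continuous (fun _ : 'rV[R]_n => a) by exact: cst_continuous.
  have c_norm : continuous (fun u : 'rV[R]_n => `|u|) := @norm_continuous _ 'rV[R]_n.
  move=> u clu; split.
  - apply: (closure_le (g := cst 1) c_norm (c_cst 1) _ clu).
    by move=> v [].
  - apply: (closure_le (f := cst 1) (c_cst 1) c_norm _ clu).
    by move=> v [].
  - apply: (closure_le (f := cst 0) (c_cst 0) (cdot _) _ clu).
    by move=> v [].
  move=> q Aq; apply/eqP; rewrite eq_le; apply/andP; split.
    apply: (closure_le (g := cst 0) (cdot q) (c_cst 0) _ clu).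
    by move=> v [_ _ _ /(_ _ Aq) ->].
  apply: (closure_le (f := cst 0) (c_cst 0) (cdot q) _ clu).
  by move=> v [_ _ _ /(_ _ Aq) ->].
have [] : \bigcap_(s in S) f s !=set0.
  move: cA; rewrite compact_In0; apply.
    exists f => // s _; rewrite setIidr// => u [].
    by [].
  move=> D DS; pose r := s0 :: finmap.enum_fset D.
  have rS i : S (nth s0 r i).
    have [lt|ge] := ltnP i (size r); last by rewrite nth_default.
    have := mem_nth s0 lt; rewrite inE => /predU1P[->//|iD].
    exact/set_mem/DS.
  have [c Sc cP] := finite_separation g cS (fun i : 'I_(size (finmap.enum_fset D)).+1 => rS i).
  have c0 : c - g != 0 by rewrite subr_eq0; apply: contra_notN nSg => /eqP <-.
  have nc : `|c - g| != 0 by rewrite normr_eq0.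
  have ninv : 0 <= `|c - g|^-1 by rewrite invr_ge0.
  have nu : `| `|c - g|^-1 *: (c - g)| = 1 by rewrite normrZ normrV ?unitfE// normr_id mulVf.
  exists (`|c - g|^-1 *: (c - g)) => s /= sD; split; rewrite ?nu//.
    rewrite dotZr mulr_ge0// dotC.
    have sr : s \in r by rewrite inE; apply/orP; right.
    have lt : (index s r < (size (finmap.enum_fset D)).+1)%N by rewrite index_mem.
    by have := cP (Ordinal lt); rewrite /= nth_index.
  by move=> q Aq; rewrite dotZr Aq ?mulr0.
move=> u uP; exists u; split=> [s /uP[_ _]|]; first by rewrite dotC.
apply: contrapT => noS.
have uA : Ann u.
  move=> s Ss; apply/eqP; rewrite eq_le leNgt; apply/andP; split.
    by apply/negP => us; apply: noS; exists s.
  by have [_ _] := uP s Ss; rewrite dotC.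
have [_ u1 _ /(_ u uA)/eqP] := uP s0 Ss0.
by rewrite dot_eq0 => /eqP u0; move: u1; rewrite u0 normr0 ler10.
Qed.

(** * Lower semicontinuous maps and projected solutions *)

Lemma half_pow_sum (R : realType) k : \sum_(i < k) 2^-1 ^+ i.+1 = 1 - 2^-1 ^+ k :> R.
Proof.
elim: k => [|k IH]; first by rewrite big_ord0 subrr.
by rewrite big_ord_recr/= IH exprS; move: (2^-1 ^+ k) => a; field.
Qed.

(* The weighted sum g of a dense family of selections of the closures has
   g x in Phi x as soon as g x = x: otherwise a hyperplane through x properly
   supports Phi x, and every selection, hence Phi x, would lie on it. *)
Theorem lsc_fixed_point (R : realType) n (B : set 'rV[R]_n)
    (Phi : 'rV[R]_n -> set 'rV[R]_n) :
  compact B -> convex_set B -> lsc_convex B Phi -> exists x, Phi x x.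
Proof.
move=> cB cvB lcPhi; have [lPhi Phi0 cPhi PhiB] := lcPhi.
have [F [FP Fdense]] := dense_selections cB cvB lcPhi.
have [M M0 BM] : exists2 M : R, 0 <= M & forall y, B y -> `|y| <= M.
  have [M [_ MB]] := compact_bounded cB.
  exists (Num.max M 0 + 1); first by rewrite addr_ge0// le_max lexx orbT.
  by move=> y; apply: MB; rewrite ltr_pwDr// le_max lexx.
have FM i x : `|F i x| <= M by apply: BM; have [] := FP i.
have w0 i : 0 < 2^-1 ^+ i :> R by rewrite exprn_gt0.
pose P k x := \sum_(i < k) 2^-1 ^+ i.+1 *: F i x.
have [k|k x|k x|g cg gP] :=
    @uniform_limit_compact _ _ _ _ P M (@closed_ball_rV_compact R n M).
- apply: continuous_sum => i x; apply: (@continuousZ _ _ _ (cst _) (F i)).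
    exact: cst_continuous.
  by have [cF _ _] := FP i; exact: cF.
- rewrite /= (le_trans (ler_norm_sum _ _ _))//.
  apply: (@le_trans _ _ (\sum_(i < k) 2^-1 ^+ i.+1 * M)).
    by apply: ler_sum => i _; rewrite normrZ gtr0_norm// ler_wpM2l// ltW.
  by rewrite -mulr_suml half_pow_sum ler_piMl// gerBl ltW.
- rewrite /P big_ord_recr/= addrAC subrr add0r normrZ gtr0_norm// exprS mulrC.
  rewrite ler_pM ?FM ?mulr_ge0 ?invr_ge0 ?(ltW (w0 k))//.
  by rewrite ler_piMl ?(ltW (w0 k))// invf_le1// ler1n.
(* The radius [M *+ 2] is the estimate at [k = 0], where the partial sum vanishes. *)
have [x gx] : exists x, g x = x.
  apply: (schauder cg (@closed_ball_rV_compact R n (M *+ 2))) => x /=.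
  by have := gP 0 x; rewrite /P big_ord0 subr0 expr0 mulr1.
exists x; apply: contrapT => nxx.
have [p [p_ge0 [s xs ps]]] := proper_separation (cPhi x) (Phi0 x) nxx.
have cdot : continuous (fun y => dot p (y - x)).
  apply: dot_continuous; first exact: cst_continuous.
  by move=> y; exact: (cvgB cvg_id (cvg_cst x)).
have a0 i : 0 <= dot p (F i x - x).
  have [_ _ /(_ x) Fx] := FP i.
  apply: (closure_le (f := cst 0) _ cdot _ Fx); last exact: p_ge0.
  exact: cst_continuous.
pose D := \sum_i `|p 0 i|.
have D0 : 0 <= D by exact: sumr_ge0.
(* The first [k] weights sum to 1 minus the k-th power of 1/2; this deficit multiplies [dot p x]. *)
have sumE k : \sum_(i < k) 2^-1 ^+ i.+1 * dot p (F i x - x) =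
    dot p (P k x - x) + 2^-1 ^+ k * dot p x.
  under eq_bigr do rewrite dotBr mulrBr.
  rewrite sumrB -mulr_suml half_pow_sum dotBr /P dot_sumr.
  under [in RHS]eq_bigr do rewrite dotZr.
  by rewrite mulrBl mul1r opprB addrA addrAC.
have le_pow k : dot p (P k x - x) + 2^-1 ^+ k * dot p x <=
    (D * (M *+ 2) + `|dot p x|) * 2^-1 ^+ k.
  rewrite mulrDl lerD//; last by rewrite mulrC ler_wpM2r ?ler_norm// ltW.
  rewrite (le_trans (dot_bound _ _))// -mulrA ler_wpM2l//.
  by rewrite distrC; have := gP k x; rewrite gx.
(* The terms are non-negative and, since [g x = x], their weighted partial sums tend to 0. *)
have aE j : dot p (F j x - x) = 0.
  apply/eqP; rewrite eq_le a0 andbT leNgt; apply/negP => aj.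
  have e0 : 0 < 2^-1 ^+ j.+1 * dot p (F j x - x) by rewrite mulr_gt0.
  have c0 : 0 <= D * (M *+ 2) + `|dot p x| by rewrite addr_ge0// mulr_ge0// mulrn_wge0.
  have [k kP] := half_pow_small c0 e0.
  have := le_pow (j.+1 + k)%N; rewrite -sumE leNgt => /negP; apply.
  have jk : (j < j.+1 + k)%N by rewrite ltn_addr.
  rewrite (bigD1 (Ordinal jk))//=; apply: le_lt_trans (lt_le_trans kP _).
    rewrite ler_wpM2l// exprD ler_piMl ?(ltW (w0 k))// exprn_ile1 ?invr_ge0//.
    by rewrite invf_le1// ler1n.
  by rewrite lerDl sumr_ge0// => i _; rewrite mulr_ge0// ltW.
(* By [dot_bound], a selection this close to [s] would lie strictly on the positive side of the
   hyperplane, against [aE]. *)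
have e0 : 0 < dot p (s - x) / (D + 1) by rewrite divr_gt0// ltr_wpDl.
have [i] := Fdense x s _ xs e0; rewrite ltr_pdivlMr ?ltr_wpDl// ltNge => /negP; apply.
rewrite -(subrK (F i x) s) -addrA dotDr aE addr0 (le_trans (dot_bound _ _))//.
by rewrite subrK mulrC ler_wpM2l// lerDl.
Qed.

(** * From nets to neighbourhoods *)

Definition nat_directed : directedSet :=
  @DirectedSet nat (fun m n => m <= n)%N (inhabits 0%N) leqnn
    (fun i j k => @leq_trans j i k)
    (fun i j => ex_intro _ (maxn i j) (conj (leq_maxl i j) (leq_maxr i j))).

(** Otherwise a sequence in [A] tends to [x] while its values stay at distance at least [e] from
    [y]; viewed as a net, it has no subnet with selections converging to [y]. *)
Lemma lower_semicontinuous_on_near (R : realType) (U V : normedModType R)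
    (A : set U) (Phi : U -> set V) x y e :
  lower_semicontinuous_on A Phi -> A x -> Phi x y -> 0 < e ->
  \forall x' \near x, A x' -> exists2 y', Phi x' y' & `|y - y'| < e.
Proof.
move=> lPhi Ax xy e0; apply: contrapT => nnear.
have /choice[u uP] : forall k, exists x', [/\ A x', `|x - x'| < k.+1%:R^-1 &
    forall y', Phi x' y' -> e <= `|y - y'|].
  move=> k; apply: contrapT => nox; apply: nnear; apply/nbhs_ballP.
  exists k.+1%:R^-1 => /=; first by rewrite invr_gt0.
  move=> x'; rewrite -ball_normE /= => xx' Ax'; apply: contrapT => noy.
  apply: nox; exists x'; split=> // y' xy'; rewrite leNgt; apply/negP => yy'.
  by apply: noy; exists y'.
have cu : @net_cvg U nat_directed u x.
  move=> S /nbhs_ballP[d /= d0 dS]; have [N NP] := natr_div_small 1 d0.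
  exists N => k /NP; rewrite mul1r => kd; apply: dS; rewrite -ball_normE /=.
  by apply: lt_trans kd; have [] := uP k.
have [|J [phi [v [_ cv vP]]]] := lPhi x Ax nat_directed u _ cu y xy.
  by move=> k; have [] := uP k.
have /cv[j0 j0P] : nbhs y (ball y e) by exact: nbhsx_ballx.
have := j0P j0 (dle_refl j0); rewrite /= -ball_normE /=.
by have [_ _ /(_ _ (vP j0))] := uP (phi j0); rewrite leNgt => /negP.
Qed.

Lemma prod_norm_fst (R : realType) (U V : normedModType R) (p : U * V) : `|p.1| <= `|p|.
Proof. by rewrite prod_normE le_max lexx. Qed.

Lemma prod_norm_snd (R : realType) (U V : normedModType R) (p : U * V) : `|p.2| <= `|p|.
Proof. by rewrite prod_normE le_max lexx orbT. Qed.

(** * The Euclidean projection *)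

Lemma enorm_le (R : realType) n (x y : 'rV[R]_n) :
  (enorm x <= enorm y) = (dot x x <= dot y y).
Proof.
have E (v : 'rV[R]_n) : enorm v = Num.sqrt (dot v v).
  by congr Num.sqrt; apply: eq_bigr => i _; rewrite expr2.
by rewrite !E ler_sqrt// dot_ge0.
Qed.

(** By the parallelogram identity, the midpoint of two distinct nearest points would be strictly
    closer to [z]. *)
Lemma proj_unique (R : realType) n (C : set 'rV[R]_n) (z x x' : 'rV[R]_n) :
  convex_set C -> Defs.proj C z x -> Defs.proj C z x' -> x = x'.
Proof.
move=> cC [Cx xmin] [Cx' x'min].
have h0 : 0 <= 2^-1 :> R by rewrite invr_ge0.
have h1 : 2^-1 <= 1 :> R by rewrite invf_le1// ler1n.
have Cm := convex_setE cC Cx Cx' h0 h1; move: (xmin _ Cm); rewrite enorm_le.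
have := xmin _ Cx'; have := x'min _ Cx; rewrite !enorm_le.
have -> : z - (2^-1 *: x + (1 - 2^-1) *: x') = 2^-1 *: ((z - x) + (z - x')).
  have -> : 1 - 2^-1 = 2^-1 :> R by field.
  rewrite -scalerDr addrACA -opprD scalerBr; congr (_ - _).
  by rewrite scalerDr -scalerDl [X in X *: _](_ : _ = 1) ?scale1r//; field.
move=> xx' x'x xm.
suff : dot ((z - x') - (z - x)) ((z - x') - (z - x)) == 0.
  by rewrite dot_eq0 opprB addrC addrA subrK subr_eq0 => /eqP.
move: xx' x'x xm; move: (z - x) (z - x') => a b.
rewrite eq_le dot_ge0 andbT dotZr [dot (_ *: _) _]dotC dotZr dotDr dotBr.
rewrite [dot (a + b) a]dotC [dot (a + b) b]dotC [dot (b - a) b]dotC [dot (b - a) a]dotC.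
rewrite !dotBr !dotDr [dot b a]dotC.
by move: (dot a a) (dot b b) (dot a b) => p q r; lra.
Qed.

(** * Existence of a projected solution *)

Lemma continuous_pair (T U V : topologicalType) (f : T -> U) (g : T -> V) :
  continuous f -> continuous g -> continuous (fun x => (f x, g x)).
Proof. by move=> cf cg x; apply: cvg_pair; [exact: cf|exact: cg]. Qed.

Lemma near_comp (T U : topologicalType) (h : T -> U) (P : U -> Prop) x :
  {for x, continuous h} -> (\forall y \near h x, P y) -> \forall y \near x, P (h y).
Proof. by move=> ch; exact: ch. Qed.

Theorem theorem4p1 (R : realType) (n : nat) (C : set 'rV[R]_n)
    (K : 'rV[R]_n -> set 'rV[R]_n) (f : 'rV[R]_n -> 'rV[R]_n -> R)
    (C_neq0 : C !=set0) (C_compact : compact C) (C_convex : convex_set C)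
    (Q_lsc : lower_semicontinuous_on (dom C) (Qmap C K))
    (Q_neq0 : forall p, dom C p -> Qmap C K p !=set0)
    (Q_convex : forall p, dom C p -> convex_set (Qmap C K p))
    (Q_compact : relatively_compact (image_sv (Qmap C K) (dom C)))
    (FixQ_closed : closed (Fix (dom C) (Qmap C K)))
    (R_lsc : lower_semicontinuous_on (Fix (dom C) (Qmap C K)) (Rmap K f))
    (R_convex : forall p, Fix (dom C) (Qmap C K) p -> convex_set (Rmap K f p))
    (f_ge0 : forall z, Mset C K z -> 0 <= f z z) :
  exists x0, projected_solution C K f x0.
Proof.
have [c0 Cc0] := C_neq0.
have /choice[pi piP] : forall z, exists x, Defs.proj C z x.
  by move=> z; have [] := Q_neq0 (c0, z); [split|move=> [x y] [xP _]; exists x].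
have Cpi z : C (pi z) by have [] := piP z.
have c_id : continuous (fun z : 'rV[R]_n => z) by move=> z; exact: cvg_id.
have dom_c0 z : dom C (c0, z) by [].
have c_c0 : continuous (fun z : 'rV[R]_n => (c0, z)).
  by apply: (continuous_pair (f := cst c0)) => //; exact: cst_continuous.
(* Lower semicontinuity of a single-valued map is continuity; it is read off the first component of
   [Qmap] with [c0] held fixed. *)
have c_pi : continuous pi.
  move=> z; apply/(@cvgrPdist_lt _ _ _ (nbhs z) (nbhs_filter z)) => e e0.
  have [[u y] [_ /= c0y]] := Q_neq0 _ (dom_c0 z).
  have zy : Qmap C K (c0, z) (pi z, y) by split=> //=; exact: piP.
  have : \forall z' \near z, dom C (c0, z') ->
      exists2 q, Qmap C K (c0, z') q & `|(pi z, y) - q| < e.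
    exact: (near_comp (c_c0 z) (lower_semicontinuous_on_near Q_lsc (dom_c0 z) zy e0)).
  apply: filterS => z' /= [//|[u' y'] [/= u'P _] d].
  rewrite -(proj_unique C_convex u'P (piP z')).
  exact: le_lt_trans (prod_norm_fst (_, _)) d.
have c_graph : continuous (fun z => (pi z, z)).
  exact: continuous_pair.
have dom_pi z : dom C (pi z, z) by split=> //; exact: Cpi.
have lK : lsc (fun z => K (pi z)).
  move=> z y e zy e0.
  have zy' : Qmap C K (pi z, z) (pi z, y) by split=> //=; exact: piP.
  have : \forall z' \near z, dom C (pi z', z') ->
      exists2 q, Qmap C K (pi z', z') q & `|(pi z, y) - q| < e.
    exact: (near_comp (c_graph z) (lower_semicontinuous_on_near Q_lsc (dom_pi z) zy' e0)).
  apply: filterS => z' /= [//|[u' y'] [/= _ y'K] d]; exists y' => //.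
  exact: le_lt_trans (prod_norm_snd (_, _)) d.
have K0 z : K (pi z) !=set0.
  by have [[u y] [_ yK]] := Q_neq0 _ (dom_pi z); exists y.
have cK z : convex_set (K (pi z)).
  move=> y y' t /set_mem yK /set_mem y'K.
  have Qy w : K (pi z) w -> (pi z, w) \in Qmap C K (pi z, z).
    by move=> wK; apply/mem_set; split=> //=; exact: piP.
  have /set_mem[_ yt] := Q_convex _ (dom_pi z) _ _ t (Qy _ yK) (Qy _ y'K).
  exact/mem_set.
have [M [_ MB]] := compact_bounded Q_compact.
pose r := Num.max M 0 + 1.
have KM z : K (pi z) `<=` [set y | `|y| <= r].
  move=> y zy /=; apply: (le_trans (prod_norm_snd (pi z, y))).
  apply: MB; first by rewrite ltr_pwDr// le_max lexx.
  apply: subset_closure; exists (pi z, z) => //; split=> //=; exact: piP.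
apply: contrapT => nosol.
pose Fx := Fix (dom C) (Qmap C K).
pose G := [set z | Fx (pi z, z)].
have cG : closed G by move/continuous_closedP: c_graph; exact.
(* Were this value empty, [z] would be an equilibrium on [K (pi z)] and [pi z] a projected
   solution. *)
have R0 z : G z -> Rmap K f (pi z, z) !=set0.
  move=> [_ [zP zK]]; apply: contrapT => noy; apply: nosol; exists (pi z).
  split=> //; exists z; split; last exact: piP.
  split=> // y zy; rewrite leNgt; apply/negP => fzy; apply: noy.
  by exists y.
pose Phi z := if z \in G then Rmap K f (pi z, z) else K (pi z).
have lPhi : lsc_convex [set y | `|y| <= r] Phi.
  split=> [|z|z|z].
  - apply: lsc_glue => // [z y e zG zy e0|z _ y []//].
    exact: (near_comp (c_graph z) (lower_semicontinuous_on_near R_lsc zG zy e0)).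
  - by rewrite /Phi; case: (boolP (z \in G)) => // /set_mem/R0.
  - by rewrite /Phi; case: (boolP (z \in G)) => // /set_mem/R_convex.
  - by rewrite /Phi; case: (z \in G) => // y [/= /KM].
have [z] := lsc_fixed_point (@closed_ball_rV_compact R n r)
  (@convex_closed_ball _ _ r) lPhi.
(* In [G] the fixed point gives [f z z < 0] with [z] in [Mset C K]. Outside [G] it gives
   [K (pi z) z], which puts [z] back in [G]. *)
rewrite /Phi; have [/set_mem zG [_ /= fzz]|/negP nzG zK] := boolP (z \in G).
  have : Mset C K z.
    by split; [exists (pi z) => //; case: zG => _ []|exists (pi z)].
  by move=> /f_ge0; rewrite leNgt fzz.
by apply: nzG; apply/mem_set; split=> //; split=> //=; exact: piP.
Qed.
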